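(* Let $N\ge 3$, $k_1,k_2\in\{1,2,\dots,N\}$ and $a,b\in(0,\infty)$. Let $a_1,a_2:[0,\infty)\to[0,\infty)$ and $p_1,p_2:[0,\infty)\to(0,\infty)$ be continuous. Let $f_1,f_2:[0,\infty)\to[0,\infty)$ be continuous and increasing, with $f_i(0)\ge 0$ and $f_i(s)>0$ for all $s>0$, $i=1,2$. Let $M_1,M_2,m_1,m_2$ be the constants defined in the context. Assume that there exist constants $\overline c_1,\overline c_2>0$, continuous increasing functions $h_1,h_2:[0,\infty)\to[0,\infty)$ and continuous functions $\overline\varphi_1,\overline\varphi_2:[0,\infty)\to[0,\infty)$ such that $$f_1(t_1 w_1)\le \overline c_1\, h_1(t_1)\,\overline\varphi_1(w_1)\quad\text{for all } w_1\ge 1 \text{ and all } t_1\ge M_1 f_2^{1/k_2}(a),$$ $$f_2(t_2 w_2)\le \overline c_2\, h_2(t_2)\,\overline\varphi_2(w_2)\quad\text{for all } w_2\ge 1 \text{ and all } t_2\ge M_2 f_1^{1/k_1}(b).$$ With $H_{1,2},H_{2,1},\overline P_{1,2},\overline P_{2,1},\underline P_{1,2},\underline P_{2,1}$ as defined in the context, assume $H_{1,2}(\infty)=H_{2,1}(\infty)=\infty$. Then the system $$\begin{cases} S_{k_1}(\lambda(D^2u_1))+a_1(|x|)\,|\nabla u_1|^{k_1}=p_1(|x|)f_1(u_2), & x\in\mathbb{R}^N,\\ S_{k_2}(\lambda(D^2u_2))+a_2(|x|)\,|\nabla u_2|^{k_2}=p_2(|x|)f_2(u_1), & x\in\mathbb{R}^N,\end{cases}$$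 has at least one positive radial solution $(u_1,u_2)\in C^2([0,\infty))\times C^2([0,\infty))$ with central value $(u_1(0),u_2(0))=(a,b)$. Moreover, the following hold for this solution. 1) If $\overline P_{1,2}(\infty)<\infty$ and $\overline P_{2,1}(\infty)<\infty$, then $\lim_{r\to\infty}u_1(r)<\infty$ and $\lim_{r\to\infty}u_2(r)<\infty$. 2) If in addition there are constants $\underline c_1,\underline c_2\in(0,\infty)$ and continuous functions $\underline\varphi_1,\underline\varphi_2:[0,\infty)\to[0,\infty)$ such that $f_1(m_1w_1)\ge\underline c_1\underline\varphi_1(w_1)$ for all $w_1\ge1$ and $f_2(m_2w_2)\ge\underline c_2\underline\varphi_2(w_2)$ for all $w_2\ge1$, and if $\underline P_{1,2}(\infty)=\infty$ and $\underline P_{2,1}(\infty)=\infty$, then $\lim_{r\to\infty}u_1(r)=\infty$ and $\lim_{r\to\infty}u_2(r)=\infty$. 3) If in addition there are a constant $\underline c_2\in(0,\infty)$ and a continuous function $\underline\varphi_2:[0,\infty)\to[0,\infty)$ such that $f_2(m_2w_2)\ge\underline c_2\underline\varphi_2(w_2)$ for all $w_2\ge1$, and if $\overline P_{1,2}(\infty)<\infty$ and $\underline P_{2,1}(\infty)=\infty$, then $\lim_{r\to\infty}u_1(r)<\infty$ and $\lim_{r\to\infty}u_2(r)=\infty$. 4) If in addition there are a constant $\underline c_1\in(0,\infty)$ and a continuous function $\underline\varphi_1:[0,\infty)\to[0,\infty)$ such that $f_1(m_1w_1)\ge\underline c_1\underline\varphi_1(w_1)$ for all $w_1\ge1$, and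 if $\underline P_{1,2}(\infty)=\infty$ and $\overline P_{2,1}(\infty)<\infty$, then $\lim_{r\to\infty}u_1(r)=\infty$ and $\lim_{r\to\infty}u_2(r)<\infty$.
   Context: For a $C^2$ function $u$ on $\mathbb{R}^N$ and $k\in\{1,\dots,N\}$, $\lambda(D^2u)$ is the vector of eigenvalues of the Hessian matrix $D^2u$, and $S_k(\lambda(D^2u))$ (the $k$-Hessian operator) is the sum of all $k\times k$ principal minors of $D^2u$, i.e. the $k$-th elementary symmetric polynomial of the eigenvalues. A radial solution is a solution with $u_i(x)=u_i(|x|)$; the same letter denotes the function of $r=|x|\in[0,\infty)$. The notation $f^{1/k}(t)$ means $(f(t))^{1/k}$, and similarly for $h^{1/k}$. Constants: $M_1=b/f_2^{1/k_2}(a)$ if $b>f_2^{1/k_2}(a)$ and $M_1=1$ if $b\le f_2^{1/k_2}(a)$; $M_2=a/f_1^{1/k_1}(b)$ if $a>f_1^{1/k_1}(b)$ and $M_2=1$ if $a\le f_1^{1/k_1}(b)$; $m_1=\min\{b,f_2^{1/k_2}(a)\}$, $m_2=\min\{a,f_1^{1/k_1}(b)\}$; $C_0=\dfrac{(N-1)!}{k_1!(N-k_1)!}$, $C_{00}=\dfrac{(N-1)!}{k_2!(N-k_2)!}$. Functions: $$G_1^-(\xi)=\frac{\xi^{k_2-N}}{C_{00}}e^{-\int_0^\xi \frac{1}{C_{00}}t^{k_2-1}a_2(t)\,dt},\qquad G_1^+(\xi)=\xi^{N-1}e^{\int_0^\xi \frac{1}{C_{00}}t^{k_2-1}a_2(t)\,dt}\,p_2(\xi),$$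 $$G_2^-(\xi)=\frac{\xi^{k_1-N}}{C_0}e^{-\int_0^\xi \frac{1}{C_0}t^{k_1-1}a_1(t)\,dt},\qquad G_2^+(\xi)=\xi^{N-1}e^{\int_0^\xi \frac{1}{C_0}t^{k_1-1}a_1(t)\,dt}\,p_1(\xi),$$ $$\overline P_{1,2}(r)=\int_0^r\Big[G_2^-(y)\int_0^yG_2^+(t)\,\overline\varphi_1\Big(1+\int_0^t\Big(G_1^-(z)\int_0^zG_1^+(\xi)d\xi\Big)^{1/k_2}dz\Big)dt\Big]^{1/k_1}dy,$$ $$\overline P_{2,1}(r)=\int_0^r\Big[G_1^-(y)\int_0^yG_1^+(t)\,\overline\varphi_2\Big(1+\int_0^t\Big(G_2^-(z)\int_0^zG_2^+(\xi)d\xi\Big)^{1/k_1}dz\Big)dt\Big]^{1/k_2}dy.$$ $\underline P_{1,2}(r)$ is given by the same formula as $\overline P_{1,2}(r)$ with $\overline\varphi_1$ replaced by $\underline\varphi_1$, and $\underline P_{2,1}(r)$ by the same formula as $\overline P_{2,1}(r)$ with $\overline\varphi_2$ replaced by $\underline\varphi_2$ (whenever $\underline\varphi_1$, respectively $\underline\varphi_2$, is given). $$H_{1,2}(r)=\int_a^r\frac{dt}{h_1^{1/k_1}\big(M_1f_2^{1/k_2}(t)\big)},\qquad H_{2,1}(r)=\int_b^r\frac{dt}{h_2^{1/k_2}\big(M_2f_1^{1/k_1}(t)\big)}.$$ For each of these functions, the value at $\infty$ denotes the limit as the argument tends to $\infty$, e.g. $\overline P_{1,2}(\infty)=\lim_{r\to\infty}\overline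 P_{1,2}(r)$ and $H_{1,2}(\infty)=\lim_{s\to\infty}H_{1,2}(s)$. *)

(* Defs.v *)
From HB Require Import structures.
From mathcomp Require Import all_boot all_order all_algebra.
From mathcomp Require Import all_classical all_reals all_analysis.

Set Implicit Arguments.
Unset Strict Implicit.
Unset Printing Implicit Defensive.

Import Order.TTheory GRing.Theory Num.Theory.
Import numFieldTopology.Exports numFieldNormedType.Exports.

Local Open Scope classical_set_scope.
Local Open Scope ring_scope.

Section Hessian.
Context {R : realType} {N : nat}.
Implicit Types (x : 'rV[R]_N) (U : 'rV[R]_N -> R).

(* The library norm on 'rV[R]_N is the maximum norm; |x| and |grad u| are
   Euclidean. *)
Definition enorm x : R := Num.sqrt (\sum_(i < N) x ord0 i ^+ 2).

Definition partial (i : 'I_N) U : 'rV[R]_N -> R := 'D_(delta_mx ord0 i) U.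

Definition grad U x : 'rV[R]_N := \row_i partial i U x.

Definition hessian U x : 'M[R]_N :=
  \matrix_(i, j) partial i (partial j U) x.

(* [derive] is total, so the existence of the derivatives has to be required
   explicitly. *)
Definition C2_space U : Prop :=
  [/\ continuous U,
      forall i x, derivable U x (delta_mx ord0 i),
      forall i, continuous (partial i U),
      forall i j x, derivable (partial j U) x (delta_mx ord0 i)
    & forall i j, continuous (partial i (partial j U))].

(* S_k(lambda(A)) as the sum of the k x k principal minors of A. *)
Definition Sk (k : nat) (A : 'M[R]_N) : R :=
  \sum_(I : {set 'I_N} | #|I| == k)
    \det (\matrix_(i < #|I|, j < #|I|) A (enum_val i) (enum_val j)).

Definition hessian_eq (k : nat) (a p f : R -> R) U V : Prop :=
  forall x, Sk k (hessian U x) + a (enorm x) * enorm (grad U x) ^+ k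
            = p (enorm x) * f (V x).

End Hessian.

Section HalfLine.
Context {R : realType}.
Implicit Types f g : R -> R.

(* Functions on [0, oo[ are represented by functions on R, of which only the
   restriction to [0, oo[ matters. *)
Definition continuous_halfline f : Prop :=
  {within [set r : R | 0 <= r], continuous f}.

Definition nonneg_halfline f : Prop := forall r : R, 0 <= r -> 0 <= f r.

Definition pos_halfline f : Prop := forall r : R, 0 <= r -> 0 < f r.

Definition nondecreasing_halfline f : Prop :=
  forall r s : R, 0 <= r -> r <= s -> f r <= f s.

(* Derivative relative to [0, oo[, hence one-sided at 0. *)
Definition has_deriv_halfline f g : Prop :=
  forall r : R, 0 <= r ->
    (f s - f r) / (s - r) @[s --> within [set s : R | 0 <= s] r^'] --> g r.

Definition C2_halfline f : Prop :=
  exists f1 f2 : R -> R,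
    [/\ has_deriv_halfline f f1, has_deriv_halfline f1 f2
      & continuous_halfline f2].

Definition lim_finite f : Prop := cvg (f r @[r --> +oo]).

Definition lim_infinite f : Prop := f r @[r --> +oo] --> +oo.

End HalfLine.

Section Data.
Context {R : realType}.
Implicit Types (N k : nat) (a p f h phi : R -> R).

Local Notation mu := (@lebesgue_measure R).

(* [powR] satisfies 0 `^ x = 0 for x != 0, so this is the k-th root on
   [0, oo[ including at 0. *)
Definition kroot k (x : R) : R := x `^ (k%:R^-1).

Definition C0 N k : R := (N.-1)`!%:R / (k`! * (N - k)`!)%:R.

Definition intfactor N k a (xi : R) : R :=
  expR (\int[mu]_(t in `[0, xi]) (1 / C0 N k * t ^+ k.-1 * a t)).

(* At xi = 0 the exponent k - N may be negative; the value is then 0 by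
   convention, which does not affect the integrals below. *)
Definition Gminus N k a (xi : R) : R :=
  xi ^ (k%:Z - N%:Z) / C0 N k * (intfactor N k a xi)^-1.

Definition Gplus N k a p (xi : R) : R :=
  xi ^+ N.-1 * intfactor N k a xi * p xi.

Definition Q N k a p (t : R) : R :=
  \int[mu]_(z in `[0, t])
    kroot k (Gminus N k a z * \int[mu]_(xi in `[0, z]) Gplus N k a p xi).

(* P_{1,2} is [P N k1 a1 p1 k2 a2 p2 phi1] and
   P_{2,1} is [P N k2 a2 p2 k1 a1 p1 phi2]. *)
Definition P N k a p k' a' p' phi (r : R) : R :=
  \int[mu]_(y in `[0, r])
    kroot k (Gminus N k a y *
      \int[mu]_(t in `[0, y])
        (Gplus N k a p t * phi (1 + Q N k' a' p' t))).

(* M_1 is [Mconst k2 f2 a b] and M_2 is [Mconst k1 f1 b a]. *)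
Definition Mconst k f (c d : R) : R :=
  if kroot k (f c) < d then d / kroot k (f c) else 1.

(* m_1 is [mconst k2 f2 a b] and m_2 is [mconst k1 f1 b a]. *)
Definition mconst k f (c d : R) : R := Num.min d (kroot k (f c)).

(* H_{1,2} is [H k1 h1 (Mconst k2 f2 a b) k2 f2 a] and
   H_{2,1} is [H k2 h2 (Mconst k1 f1 b a) k1 f1 b]. *)
Definition H k h (M : R) k' f (c r : R) : R :=
  \int[mu]_(t in `[c, r]) (kroot k (h (M * kroot k' (f t))))^-1.

End Data.

(* Main.v *)
Require Import Defs.
From HB Require Import structures.
From mathcomp Require Import all_boot all_order all_algebra.
From mathcomp Require Import all_classical all_reals all_analysis.
From mathcomp Require Import measurable_realfun ring lra.

Import Order.TTheory GRing.Theory Num.Theory.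
Import numFieldTopology.Exports numFieldNormedType.Exports.

Set Implicit Arguments.
Unset Strict Implicit.
Unset Printing Implicit Defensive.

Local Open Scope classical_set_scope.
Local Open Scope ring_scope.

(* With w = r^(N-k) u'^k and the integrating factor E = exp (int r^(k-1) a / C0),
   the radial equation reads (E w)' = r^(N-1) E p f(v) / C0, so the system is the
   fixed point problem u1 = T1 u2, u2 = T2 u1 for two order-preserving integral
   operators.  If v <= T1 (T2 v) =: w with v nondecreasing, then T2 v is at most
   M1 f2(w)^(1/k2) (1 + Q), whence H12(w(r)) <= cbar1^(1/k1) P12(r); as H12 is
   coercive, subsolutions are locally bounded, and their pointwise supremum is a
   fixed point by Tarski's argument.  The same inequality bounds the solution
   when P12 is bounded, while u2 >= m1 (1 + Q) gives u1 >= a + c P12.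
   Writing u' = r g(r) with g^k = r^(-N) E^(-1) C0^(-1) int_0^r r^(N-1) E p f(v),
   g is positive and continuous up to 0 and r g'(r) -> 0; the Hessian of u(|x|)
   is g Id + r g' (x x^T) / |x|^2, whose S_k is computed from the determinant of a
   rank one perturbation of a scalar matrix. *)

(** * Continuity and primitives on the half-line *)

(** Existence goes through order rather than compactness, so no convergence of approximations has to
    be shown. The price is that the supremum of the subsolutions is only known to be nondecreasing;
    the operators are therefore studied on locally bounded measurable sources, and applying them
    returns first continuity, then C^2 regularity. The estimate on [H12] is separation of variables:
    w' is at most (cbar1 h1(M1 f2(w)^(1/k2)))^(1/k1) times the derivative of P12, and H12 is a
    primitive of the reciprocal of h1(M1 f2(.)^(1/k2))^(1/k1). It is proved for subsolutions so that
    one bound serves the whole family. The other obstacle is the origin, where r^(k-N) and x/|x| are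
    singular. Working with g and s = r g', both continuous on [0, oo) with s(0) = 0, removes the
    singularities: the gradient is g x, and derivatives at 0 are recovered as limits of derivatives
    nearby. *)

Section Calculus.
Context {R : realType}.
Implicit Types (f g F : R -> R) (r : R).
Local Notation mu := (@lebesgue_measure R).

(** The even extension of [f] replaces continuity within a closed set by continuity on the whole
    line, so the usual limit rules apply at 0 as well. *)
Lemma continuous_halflineP f :
  continuous_halfline f <-> continuous (fun x : R => f `|x|).
Proof.
split=> cf.
  move=> x; have {}cf : f y @[y --> within [set r : R | 0 <= r] (nbhs `|x|)] --> f `|x|.
    by move/subspace_continuousP : cf; apply; exact: normr_ge0.
  apply: (@cvg_comp _ _ _ (fun y : R => `|y|) f _ _ _ _ cf) => U.
  rewrite /within/= => nU.
  have : \forall y \near x, 0 <= `|y| -> U `|y| by exact: (@norm_continuous _ R^o x _ nU).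
  by apply: filterS => y; apply; exact: normr_ge0.
apply: (@subspace_eq_continuous _ _ _ (fun x : R => f `|x|) f).
  by move=> x; rewrite inE/= => x0; rewrite /from_subspace ger0_norm.
exact: continuous_subspaceT.
Qed.

Lemma cvg_halfline f (x : R) : continuous_halfline f ->
  f `|y| @[y --> x] --> f `|x|.
Proof. by move=> /continuous_halflineP; exact. Qed.

(** The class of sources for the integral operators. It contains the continuous functions and also
    the nondecreasing ones, such as a pointwise supremum of monotone functions, and it gives
    integrability on each [[0, r]]. *)
Definition loc_bounded_measurable F := forall r, 0 <= r ->
  measurable_fun `[0, r] F /\ exists C : R, forall t : R, 0 <= t <= r -> `|F t| <= C.

Lemma continuous_halfline_itv f r :
  continuous_halfline f -> {within `[0, r], continuous f}.
Proof. by apply: continuous_subspaceW => x /=; rewrite in_itv/= => /andP[]. Qed.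

Lemma continuous_halfline_at f r :
  continuous_halfline f -> 0 < r -> {for r, continuous f}.
Proof.
move=> /continuous_halflineP/(_ r) cf r0; rewrite /prop_for/continuous_at in cf *.
rewrite gtr0_norm// in cf; apply: cvg_trans cf; apply: near_eq_cvg.
by near=> x; rewrite gtr0_norm//; near: x; exact: lt_nbhsr.
Unshelve. all: by end_near. Qed.

Lemma loc_bounded_measurable_continuous F : continuous_halfline F ->
  loc_bounded_measurable F.
Proof.
move=> cF r r0; have cFr := continuous_halfline_itv (r := r) cF; split.
  exact: subspace_continuous_measurable_fun.
have [M [_ FM]] := compact_bounded (continuous_compact cFr (@segment_compact _ _ _)).
exists (M + 1) => t tr; apply: FM; first by rewrite ltrDl.
by exists t => //=; rewrite in_itv.
Qed.

Lemma loc_bounded_measurable_nondecreasing F : nondecreasing_halfline F ->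
  loc_bounded_measurable F.
Proof.
move=> ndF r r0; split; last first.
  exists (`|F 0| + `|F r|) => t /andP[t0 tr].
  have := ndF _ _ (lexx 0) t0; have := ndF _ _ t0 tr.
  move: (F t) (F 0) (F r) => x y z.
  by case: (ger0P x); case: (ger0P y); case: (ger0P z); lra.
apply: (@eq_measurable_fun _ _ _ _ `[0, r] (fun x : R => F (Num.max 0 x)) F).
  by move=> x; rewrite inE/= in_itv/= => /andP[x0 _]; rewrite max_r.
apply: nondecreasing_measurable => // x y xy; apply: ndF.
  by rewrite le_max lexx.
by rewrite ge_max !le_max lexx/= xy orbT.
Qed.

Lemma loc_bounded_measurableM F G : loc_bounded_measurable F ->
  loc_bounded_measurable G -> loc_bounded_measurable (fun x => F x * G x).
Proof.
move=> hF hG r r0; have [mF [C hC]] := hF r r0; have [mG [D hD]] := hG r r0.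
split; first exact: measurable_funM.
exists (C * D) => t tr; rewrite normrM; apply: ler_pM => //; [exact: hC|exact: hD].
Qed.

Lemma loc_bounded_measurable_integrable F r : loc_bounded_measurable F ->
  mu.-integrable `[0, r] (EFin \o F).
Proof.
move=> hF; have [r0|r0] := leP 0 r; last first.
  by rewrite set_itv_ge ?bnd_simp -?ltNge//; exact: integrable_set0.
have [mF [C hC]] := hF r r0; apply: measurable_bounded_integrable => //.
  have := @lebesgue_measure_itv R `[0, r].
  by rewrite /= => ->; case: ifP => //; rewrite ltry.
exists C; split; first exact: num_real.
move=> M CM t /=; rewrite in_itv/= => tr.
by apply: le_trans (hC _ tr) _; exact: ltW.
Qed.

Definition prim F r := \int[mu]_(t in `[0, r]) F t.

Lemma prim0 F : prim F 0 = 0.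
Proof. by rewrite /prim set_itv1 Rintegral_set1. Qed.

Lemma prim_ge0 F r : (forall t : R, 0 <= t <= r -> 0 <= F t) -> 0 <= prim F r.
Proof. by move=> F0; apply: Rintegral_ge0 => t /=; rewrite in_itv/=; exact: F0. Qed.

Lemma eq_prim F G r : (forall t : R, 0 <= t <= r -> F t = G t) -> prim F r = prim G r.
Proof. by move=> FG; apply: eq_Rintegral => t; rewrite inE/= in_itv/=; exact: FG. Qed.

Lemma le_prim F G r : loc_bounded_measurable F -> loc_bounded_measurable G ->
  (forall t : R, 0 <= t <= r -> F t <= G t) -> prim F r <= prim G r.
Proof.
by move=> hF hG FG; apply: le_Rintegral => //; exact: loc_bounded_measurable_integrable.
Qed.

Lemma primZ c F r : loc_bounded_measurable F ->
  prim (fun t => c * F t) r = c * prim F r.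
Proof.
by move=> hF; apply: RintegralZl => //; exact: loc_bounded_measurable_integrable.
Qed.

Lemma prim_cst c r : 0 <= r -> prim (fun=> c) r = c * r.
Proof.
move=> r0; rewrite /prim Rintegral_cst//; congr (_ * _).
have := @lebesgue_measure_itv R `[0, r]; rewrite /= lte_fin => ->.
by move: r0; rewrite le_eqVlt => /predU1P[<-|->]; rewrite ?ltxx//= oppr0 addr0.
Qed.

Lemma prim_continuous F : loc_bounded_measurable F -> continuous_halfline (prim F).
Proof.
move=> hF; apply/subspace_continuousP => r /= r0.
(* The right end is moved past [r], so that the half-line and [[0, r + 1]] agree near [r]. *)
have r1 : 0 <= r + 1 by lra.
have /subspace_continuousP := parameterized_integral_continuous r1
  (loc_bounded_measurable_integrable (r + 1) hF).
have rr : [set` `[0, r + 1]] r by rewrite /= in_itv/=; apply/andP; split => //; lra.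
move=> /(_ r rr) cF; apply: cvg_trans cF; apply: cvg_app => U.
rewrite /within/= /nbhs/= => nU; near=> x => x0.
have : [set` `[0, r + 1]] x.
  by rewrite /= in_itv/= x0/=; apply/ltW; near: x; apply: lt_nbhsl; lra.
by near: x.
Unshelve. all: by end_near. Qed.

Lemma is_derive_prim F r : loc_bounded_measurable F -> 0 < r ->
  {for r, continuous F} -> is_derive r 1 (prim F) (F r).
Proof.
move=> hF r0 cF; have r1 : r < r + 1 by lra.
have [d <-] := continuous_FTC1_closed r1
  (loc_bounded_measurable_integrable (r + 1) hF) r0 cF.
by rewrite derive1E; exact: derivableP.
Qed.

Lemma prim_sub F r s : loc_bounded_measurable F -> 0 <= r -> r <= s ->
  prim F s - prim F r = \int[mu]_(t in `[r, s]) F t.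
Proof.
move=> hF r0 rs; have [->|r_neq_s] := eqVneq r s.
  by rewrite subrr set_itv1 Rintegral_set1.
rewrite /prim (Rintegral_itvB (loc_bounded_measurable_integrable s hF)) ?bnd_simp//.
rewrite Rintegral_itv_obnd_cbnd//.
apply: integrableS (loc_bounded_measurable_integrable s hF) => //.
by move=> t /=; rewrite !in_itv/= => /andP[rt ->]; rewrite (le_trans r0)// ltW.
Qed.

Lemma prim_nondecreasing F : loc_bounded_measurable F ->
  (forall t : R, 0 <= t -> 0 <= F t) -> nondecreasing_halfline (prim F).
Proof.
move=> hF F0 r s r0 rs; rewrite -subr_ge0 /prim Rintegral_itvB//.
- apply: Rintegral_ge0 => t /=; rewrite in_itv/= => /andP[rt _].
  by apply: F0; exact: le_trans r0 (ltW rt).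
- exact: loc_bounded_measurable_integrable.
Qed.

End Calculus.

(** * Derivatives and k-th roots on the half-line *)

Section CalculusB.
Context {R : realType}.
Implicit Types (f g F d : R -> R) (r x y : R) (k : nat).

Lemma nondecreasing_of_is_derive f d : continuous_halfline f ->
  (forall x : R, 0 < x -> is_derive x 1 f (d x)) -> (forall x : R, 0 < x -> 0 <= d x) ->
  nondecreasing_halfline f.
Proof.
move=> cf df d0 x y x0 xy.
have inoo z : z \in `]0, y[ -> 0 < z by rewrite in_itv/= => /andP[].
apply: (@ger0_derive1_ndecr _ f 0 y) => //.
- by move=> z /inoo z0; have := df z z0; case.
- by move=> z /inoo z0; rewrite derive1E (@derive_val _ _ _ _ _ _ _ (df z z0)) d0.
- exact: continuous_halfline_itv.
Qed.

(** L'Hopital's rule applied to (f x - f 0) / x gives the derivative at 0 as the limit of the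
    derivatives nearby. *)
Lemma is_derive_removable f d : {for 0, continuous f} -> {for 0, continuous d} ->
  (forall x : R, x != 0 -> is_derive x 1 f (d x)) -> is_derive (0 : R) 1 f (d 0).
Proof.
move=> cf cd df.
have lim : (f x - f 0) / x @[x --> (0 : R)^'] --> d 0.
  apply: (@lhopital R (fun x => f x - f 0) d id (fun=> 1) (-1) 1 0 (d 0)) => //.
  - by rewrite in_itv/=; lra.
  - move=> x; rewrite inE => -[_ /= /eqP x0]; have dfx := df x x0.
    by have := is_deriveB dfx (is_derive_cst (f 0) x 1); rewrite subr0.
  - by rewrite -[X in _ --> X](subrr (f 0)); apply: cvgB => //; exact: cvg_cst.
  - by under eq_cvg do rewrite divr1.
have lim' : h^-1 *: ((f \o shift 0) (h *: 1) - f 0) @[h --> (0 : R)^'] --> d 0.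
  apply: cvg_trans lim; apply: near_eq_cvg; near=> h.
  by rewrite /= /shift/= addr0 scaler1 mulrC.
split; first by apply/cvg_ex; exists (d 0).
exact: cvg_lim lim'.
Unshelve. all: by end_near. Qed.

Lemma kroot_ge0 k x : 0 <= kroot k x :> R.
Proof. exact: powR_ge0. Qed.

Lemma kroot_gt0 k x : 0 < x -> 0 < kroot k x :> R.
Proof. exact: powR_gt0. Qed.

Lemma le_kroot k x y : 0 <= x -> x <= y -> kroot k x <= kroot k y :> R.
Proof.
move=> x0 xy; apply: ge0_ler_powR; rewrite ?nnegrE ?invr_ge0 ?ler0n//.
exact: le_trans xy.
Qed.

Lemma krootM k x y : 0 <= x -> 0 <= y -> kroot k (x * y) = kroot k x * kroot k y :> R.
Proof. by move=> x0 y0; rewrite /kroot powRM. Qed.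

Lemma kroot0 k : (0 < k)%N -> kroot k 0 = 0 :> R.
Proof. by move=> k0; rewrite /kroot powR0// invr_eq0 pnatr_eq0 -lt0n. Qed.

Lemma kroot1 k : kroot k 1 = 1 :> R.
Proof. by rewrite /kroot powR1. Qed.

Lemma krootK k x : (0 < k)%N -> 0 <= x -> kroot k x ^+ k = x :> R.
Proof.
move=> k0 x0; rewrite -powR_mulrn ?kroot_ge0// /kroot -powRrM mulVf ?powRr1//.
by rewrite pnatr_eq0 -lt0n.
Qed.

Lemma exprK_kroot k x : (0 < k)%N -> 0 <= x -> kroot k (x ^+ k) = x :> R.
Proof.
move=> k0 x0; rewrite -powR_mulrn// /kroot -powRrM mulfV ?powRr1//.
by rewrite pnatr_eq0 -lt0n.
Qed.

Lemma is_derive_kroot k x : 0 < x ->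
  is_derive x 1 (@kroot R k) (k%:R^-1 * kroot k x / x).
Proof.
move=> x0; apply: is_derive_eq; first exact: is_derive1_powR.
by rewrite /kroot powRB ?(gt_eqF x0) ?implybT// powRr1 ?mulrA// ltW.
Qed.

(** Away from 0 the root is differentiable; at 0 the k-th powers are compared instead. *)
Lemma continuous_kroot k : (0 < k)%N -> continuous_halfline (@kroot R k).
Proof.
move=> k0; apply/continuous_halflineP => x.
have [->|x0] := eqVneq x 0.
  apply/cvgrPdist_lt => e e0; rewrite normr0 kroot0//.
  near=> y; rewrite sub0r normrN ger0_norm ?kroot_ge0//.
  rewrite -(@ltr_pXn2r _ k)// ?nnegrE ?kroot_ge0 ?(ltW e0)// krootK//.
  near: y; apply: (@nbhs0_lt _ R^o); exact: exprn_gt0.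
apply: (@continuous_comp _ _ _ (fun x : R => `|x|)); first exact: norm_continuous.
apply: differentiable_continuous; apply/derivable1_diffP.
by have := is_derive_kroot k (x := `|x|); rewrite normr_gt0 => /(_ x0) [].
Unshelve. all: by end_near. Qed.

Lemma continuous_halfline_comp f g : continuous_halfline f -> continuous_halfline g ->
  nonneg_halfline g -> continuous_halfline (f \o g).
Proof.
move=> /continuous_halflineP cf /continuous_halflineP cg g0.
apply/continuous_halflineP.
rewrite (_ : (fun x => _) = (fun y => f `|y|) \o (fun x => g `|x|)); last first.
  by apply/funext => x /=; rewrite [in RHS]ger0_norm// g0.
by move=> x; apply: continuous_comp; [exact: cg|exact: cf].
Qed.

Lemma continuous_halflineM f g : continuous_halfline f -> continuous_halfline g ->
  continuous_halfline (fun x => f x * g x).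
Proof.
move=> /continuous_halflineP cf /continuous_halflineP cg.
by apply/continuous_halflineP => x; apply: cvgM; [exact: cf|exact: cg].
Qed.

Lemma continuous_halflineD f g : continuous_halfline f -> continuous_halfline g ->
  continuous_halfline (fun x => f x + g x).
Proof.
move=> /continuous_halflineP cf /continuous_halflineP cg.
by apply/continuous_halflineP => x; apply: cvgD; [exact: cf|exact: cg].
Qed.

Lemma continuous_halflineW f : continuous f -> continuous_halfline f.
Proof. exact: continuous_subspaceT. Qed.

Lemma continuous_halfline_cst c : continuous_halfline (fun=> c : R).
Proof. by apply: continuous_halflineW => x; exact: cvg_cst. Qed.

Lemma continuous_halfline_exprn n : continuous_halfline (fun x : R => x ^+ n).
Proof. by apply: continuous_halflineW => x; exact: exprn_continuous. Qed.

Lemma eq_continuous_halfline f g : (forall r, 0 <= r -> f r = g r) ->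
  continuous_halfline f -> continuous_halfline g.
Proof.
move=> fg; rewrite !continuous_halflineP.
by rewrite (_ : (fun x => _) = (fun x => g `|x|))//; apply/funext => x; exact: fg.
Qed.

Lemma cvg_halfline_at_right0 f : continuous_halfline f -> f r @[r --> 0^'+] --> f 0.
Proof.
move=> cf; have := @cvg_halfline _ _ 0 cf; rewrite normr0.
move=> /cvg_at_right_filter; apply: cvg_trans; apply: near_eq_cvg.
by near=> r; rewrite gtr0_norm.
Unshelve. all: by end_near. Qed.

Lemma is_derive_exprn n x :
  is_derive x 1 (fun y : R => y ^+ n) (n%:R * x ^+ n.-1).
Proof.
split; first exact: exprn_derivable.
by rewrite exp_derive; exact: mulr1.
Qed.

Lemma is_derive_mul f g x df dg : is_derive x 1 f df -> is_derive x 1 g dg ->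
  is_derive x 1 (fun y => f y * g y) (df * g x + f x * dg).
Proof.
move=> hf hg; have := is_deriveM hf hg.
by rewrite addrC [g x *: df]mulrC.
Qed.

Lemma is_derive_inv f x df : f x != 0 -> is_derive x 1 f df ->
  is_derive x 1 (fun y => (f y)^-1) (- (df / f x ^+ 2)).
Proof.
move=> fx0 hf; split; first by apply: derivableV => //; case: hf.
rewrite (deriveV fx0 (@ex_derive _ _ _ _ _ _ _ hf)).
by rewrite derive_val scaleNr; congr (- _); exact: mulrC.
Qed.

End CalculusB.

(** * The radial integral operator *)

Section Operator.
Context {R : realType}.
Variables (N k : nat) (a p : R -> R).
Hypotheses (k_gt0 : (0 < k)%N) (leqkN : (k <= N)%N).
Hypotheses (ca : continuous_halfline a) (a_ge0 : nonneg_halfline a).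
Hypotheses (cp : continuous_halfline p) (p_gt0 : pos_halfline p).
Implicit Types (F G : R -> R) (r x y t : R).

Lemma N_gt0 : (0 < N)%N. Proof. exact: leq_trans leqkN. Qed.

Lemma C0_gt0 : 0 < C0 N k :> R.
Proof. by rewrite /C0 divr_gt0// ltr0n ?muln_gt0 ?fact_gt0. Qed.

Let density t := 1 / C0 N k * t ^+ k.-1 * a t.

Let continuous_density : continuous_halfline density.
Proof.
apply: continuous_halflineM ca; apply: continuous_halflineM.
  exact: continuous_halfline_cst.
exact: continuous_halfline_exprn.
Qed.

Let density_ge0 t : 0 <= t -> 0 <= density t.
Proof.
move=> t0; rewrite /density !mulr_ge0 ?exprn_ge0 ?a_ge0// ?invr_ge0 ?(ltW C0_gt0)//.
Qed.

Lemma intfactorE r : intfactor N k a r = expR (prim density r).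
Proof. by []. Qed.

Lemma continuous_intfactor : continuous_halfline (intfactor N k a).
Proof.
apply/continuous_halflineP => x.
apply: (@continuous_comp _ _ _ (fun y : R => prim density `|y|) expR).
  exact/cvg_halfline/prim_continuous/loc_bounded_measurable_continuous.
exact: continuous_expR.
Qed.

Lemma intfactor_gt0 r : 0 < intfactor N k a r.
Proof. exact: expR_gt0. Qed.

Lemma intfactor_nondecreasing : nondecreasing_halfline (intfactor N k a).
Proof.
move=> r s r0 rs; rewrite !intfactorE ler_expR; apply: prim_nondecreasing => //.
exact: loc_bounded_measurable_continuous.
Qed.

Lemma is_derive_intfactor r : 0 < r ->
  is_derive r 1 (intfactor N k a) (intfactor N k a r * density r).
Proof.
move=> r0.
have d := is_derive_prim (loc_bounded_measurable_continuous continuous_density) r0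
  (continuous_halfline_at continuous_density r0).
exact: is_derive1_comp.
Qed.

Lemma continuous_Gplus : continuous_halfline (Gplus N k a p).
Proof.
apply: continuous_halflineM cp; apply: continuous_halflineM continuous_intfactor.
exact: continuous_halfline_exprn.
Qed.

Lemma Gplus_ge0 r : 0 <= r -> 0 <= Gplus N k a p r.
Proof.
move=> r0; rewrite /Gplus !mulr_ge0 ?exprn_ge0 ?(ltW (intfactor_gt0 _))//.
by rewrite ltW// p_gt0.
Qed.

Lemma Gminus_ge0 r : 0 <= r -> 0 <= Gminus N k a r.
Proof.
move=> r0; rewrite /Gminus !mulr_ge0 ?invr_ge0 ?(ltW C0_gt0) ?(ltW (intfactor_gt0 _))//.
exact: exprz_ge0.
Qed.

(** Let [F] be the right-hand factor f(v) of one equation and u its radial solution. Then [mass] is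
    C0 E r^(N-k) u'^k, [slope] is u', [rise] is u - u(0), and [quot] is (u'/r)^k. *)
Definition mass F r := prim (fun t => Gplus N k a p t * F t) r.

Definition slope F r := kroot k (Gminus N k a r * mass F r).

Definition rise F r := prim (slope F) r.

Definition quot F r := mass F r / (r ^+ N * intfactor N k a r * C0 N k).

Lemma loc_bounded_measurable_mass F : loc_bounded_measurable F ->
  loc_bounded_measurable (fun t => Gplus N k a p t * F t).
Proof.
apply: loc_bounded_measurableM; apply: loc_bounded_measurable_continuous.
exact: continuous_Gplus.
Qed.

Lemma mass_ge0 F r : nonneg_halfline F -> 0 <= mass F r.
Proof.
move=> F0; apply: prim_ge0 => t /andP[t0 _].
by rewrite mulr_ge0 ?Gplus_ge0 ?F0.
Qed.

Lemma le_mass F G r : loc_bounded_measurable F -> loc_bounded_measurable G ->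
  (forall t : R, 0 <= t <= r -> F t <= G t) -> mass F r <= mass G r.
Proof.
move=> hF hG FG; apply: le_prim; try exact: loc_bounded_measurable_mass.
by move=> t /[dup] /andP[t0 _] tr; rewrite ler_wpM2l ?Gplus_ge0 ?FG.
Qed.

Lemma quot_ge0 F r : nonneg_halfline F -> 0 <= r -> 0 <= quot F r.
Proof.
move=> F0 r0; rewrite /quot divr_ge0 ?mass_ge0//.
by rewrite !mulr_ge0 ?exprn_ge0 ?(ltW C0_gt0) ?(ltW (intfactor_gt0 _)).
Qed.

(** Since r^(k-N) = r^k r^(-N), the singular factor of [Gminus] moves into [quot], which stays
    bounded near 0; at r = 0 both sides are 0. *)
Lemma slopeE F r : nonneg_halfline F -> 0 <= r ->
  slope F r = r * kroot k (quot F r).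
Proof.
move=> F0 r0; rewrite /slope.
have -> : Gminus N k a r * mass F r = r ^+ k * quot F r.
  have [->|r_neq0] := eqVneq r 0.
    by rewrite /mass prim0 mulr0 expr0n eqn0Ngt k_gt0 mul0r.
  rewrite /Gminus /quot expfzDr// -exprnP -invr_expz -exprnP.
  field.
  by rewrite expf_neq0// (gt_eqF C0_gt0) (gt_eqF (intfactor_gt0 _)).
by rewrite krootM ?exprn_ge0 ?quot_ge0// exprK_kroot.
Qed.

(** On [[0, y]] the weight t^(N-1) E(t) is at most its value at y, so the mass is at most y^N E(y)
    times a bound for [p F], and y^N E(y) cancels. *)
Lemma quot_bounded F r : nonneg_halfline F -> loc_bounded_measurable F -> 0 <= r ->
  exists C : R, forall y : R, 0 <= y <= r -> quot F y <= C.
Proof.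
move=> F0 hF r0.
have [_ [C hC]] := loc_bounded_measurableM
  (loc_bounded_measurable_continuous cp) hF r0.
exists (C / C0 N k) => y /andP[]; rewrite le_eqVlt => /predU1P[<- _|y0 yr].
  rewrite /quot /mass prim0 mul0r divr_ge0 ?(ltW C0_gt0)//.
  by apply: le_trans (normr_ge0 _) (hC r _); rewrite r0 lexx.
rewrite /quot ler_pdivrMr ?mulr_gt0 ?exprn_gt0 ?intfactor_gt0 ?C0_gt0//.
have -> : C / C0 N k * (y ^+ N * intfactor N k a y * C0 N k) =
    (y ^+ N.-1 * intfactor N k a y * C) * y.
  rewrite -[in y ^+ N](prednK N_gt0) exprS.
  by field; rewrite (gt_eqF C0_gt0).
have <- : prim (fun=> y ^+ N.-1 * intfactor N k a y * C) y =
    (y ^+ N.-1 * intfactor N k a y * C) * y.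
  by rewrite prim_cst// ltW.
apply: le_prim.
- exact: loc_bounded_measurable_mass.
- exact/loc_bounded_measurable_continuous/continuous_halfline_cst.
move=> t /andP[t0 ty]; rewrite /Gplus -mulrA.
apply: ler_pM.
- by rewrite mulr_ge0 ?exprn_ge0 ?(ltW (intfactor_gt0 _)).
- by rewrite mulr_ge0 ?F0 ?(ltW (p_gt0 t0)).
- apply: ler_pM; [exact: exprn_ge0|exact: ltW (intfactor_gt0 _)| |].
    by apply: lerXn2r => //; rewrite nnegrE ltW.
  exact: intfactor_nondecreasing.
- by apply: le_trans (ler_norm _) (hC t _); rewrite t0 (le_trans ty).
Qed.

Lemma continuous_quot F x : loc_bounded_measurable F -> x != 0 ->
  (fun y => quot F `|y|) @ x --> quot F `|x|.
Proof.
move=> hF x0; apply: cvgM.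
  exact/cvg_halfline/prim_continuous/loc_bounded_measurable_mass.
apply: cvgV.
  by rewrite !mulf_neq0 ?expf_neq0 ?normr_eq0// ?gt_eqF ?C0_gt0 ?intfactor_gt0.
apply: cvgM; last exact: cvg_cst.
apply: cvgM; last exact/cvg_halfline/continuous_intfactor.
apply: (@continuous_comp _ _ _ (fun y : R => `|y|) (fun y => y ^+ N)).
  exact: norm_continuous.
exact: exprn_continuous.
Qed.

(** Near 0 the slope is r times a bounded root and tends to 0, whether or not [quot] has a limit
    there. *)
Lemma continuous_slope F : nonneg_halfline F -> loc_bounded_measurable F ->
  continuous_halfline (slope F).
Proof.
move=> F0 hF.
apply: (@eq_continuous_halfline _ (fun r => r * kroot k (quot F r))).
  by move=> r r0; rewrite slopeE.
apply/continuous_halflineP => x; have [->|x0] := eqVneq x 0.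
  have [C hC] := quot_bounded F0 hF (@ler01 R).
  have C1 : 0 < kroot k C + 1 by rewrite ltr_wpDl// kroot_ge0.
  apply/cvgrPdist_le => e e0; near=> y; rewrite normr0 mul0r sub0r normrN.
  rewrite ger0_norm ?mulr_ge0 ?kroot_ge0//.
  have y1 : `|y| <= 1.
    near: y; apply: (@nbhs0_le _ R^o); exact: ltr01.
  apply: (@le_trans _ _ (`|y| * (kroot k C + 1))).
    rewrite ler_wpM2l// (@le_trans _ _ (kroot k C))// ?lerDl// le_kroot// ?quot_ge0//.
    by rewrite hC// normr_ge0.
  rewrite -ler_pdivlMr//; near: y; apply: (@nbhs0_le _ R^o).
  exact: (divr_gt0 e0 C1).
apply: cvgM; first exact: norm_continuous.
have cq := continuous_quot hF x0.
rewrite (_ : (fun y => _) = (fun y => kroot k `|y|) \o (fun y => quot F `|y|)).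
  rewrite -[kroot k (quot F `|x|)]/((fun y => kroot k y) _).
  rewrite -[quot F `|x|]ger0_norm ?quot_ge0//.
  apply: (@continuous_comp _ _ _ (fun y => quot F `|y|) (fun y => kroot k `|y|)) => //.
  exact/cvg_halfline/continuous_kroot.
by apply/funext => y /=; rewrite [in RHS]ger0_norm// quot_ge0.
Unshelve. all: by end_near. Qed.

Lemma slope_ge0 F r : 0 <= slope F r.
Proof. exact: kroot_ge0. Qed.

(** The slope is monotone in the source and homogeneous of degree 1/k, hence the factor
    [kroot k c]. *)
Lemma le_slope c F G r : 0 <= c -> 0 <= r ->
  nonneg_halfline F -> loc_bounded_measurable F -> loc_bounded_measurable G ->
  (forall t : R, 0 <= t <= r -> F t <= c * G t) ->
  slope F r <= kroot k c * slope G r.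
Proof.
move=> c0 r0 F0 hF hG FG.
have hcG : loc_bounded_measurable (fun t => c * G t).
  apply: loc_bounded_measurableM => //; apply: loc_bounded_measurable_continuous.
  exact: continuous_halfline_cst.
have FcG : mass F r <= c * mass G r.
  rewrite -primZ; last exact: loc_bounded_measurable_mass.
  apply: le_trans (le_mass hF hcG FG) _; rewrite le_eqVlt; apply/orP; left.
  by apply/eqP/eq_prim => t _; rewrite mulrCA.
(* No sign of [G] is given: for c > 0 its mass is nonnegative because c times it dominates the mass
   of [F], and for c = 0 the mass of [F] vanishes. *)
have c_or : c = 0 \/ 0 <= mass G r.
  move: c0; rewrite le_eqVlt => /predU1P[|c0]; [by left|right].
  by rewrite -(pmulr_rge0 _ c0); apply: le_trans FcG; exact: mass_ge0.
rewrite /slope; case: c_or => [c_eq0|G0].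
  have -> : mass F r = 0.
    by apply/eqP; rewrite eq_le mass_ge0// andbT; rewrite c_eq0 mul0r in FcG.
  by rewrite mulr0 kroot0// mulr_ge0 ?kroot_ge0.
rewrite -(krootM k c0 (mulr_ge0 (Gminus_ge0 r0) G0)); apply: le_kroot.
  by rewrite mulr_ge0 ?Gminus_ge0 ?mass_ge0.
by rewrite mulrCA ler_wpM2l ?Gminus_ge0.
Qed.

Lemma loc_bounded_measurable_slope F : nonneg_halfline F ->
  loc_bounded_measurable F -> loc_bounded_measurable (slope F).
Proof. by move=> *; exact/loc_bounded_measurable_continuous/continuous_slope. Qed.

Lemma rise0 F : rise F 0 = 0. Proof. exact: prim0. Qed.

Lemma rise_ge0 F r : 0 <= rise F r.
Proof. by apply: prim_ge0 => t _; exact: slope_ge0. Qed.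

Lemma continuous_rise F : nonneg_halfline F -> loc_bounded_measurable F ->
  continuous_halfline (rise F).
Proof. by move=> *; exact/prim_continuous/loc_bounded_measurable_slope. Qed.

Lemma rise_nondecreasing F : nonneg_halfline F -> loc_bounded_measurable F ->
  nondecreasing_halfline (rise F).
Proof.
move=> F0 hF; apply: prim_nondecreasing; first exact: loc_bounded_measurable_slope.
by move=> t _; exact: slope_ge0.
Qed.

Lemma is_derive_rise F r : nonneg_halfline F -> loc_bounded_measurable F ->
  0 < r -> is_derive r 1 (rise F) (slope F r).
Proof.
move=> F0 hF r0; apply: is_derive_prim => //; first exact: loc_bounded_measurable_slope.
by apply: continuous_halfline_at => //; exact: continuous_slope.
Qed.

Lemma le_rise c F G r : 0 <= c -> nonneg_halfline F -> nonneg_halfline G ->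
  loc_bounded_measurable F -> loc_bounded_measurable G ->
  (forall t : R, 0 <= t <= r -> F t <= c * G t) -> rise F r <= kroot k c * rise G r.
Proof.
move=> c0 F0 G0 hF hG FG; rewrite /rise -primZ; last exact: loc_bounded_measurable_slope.
apply: le_prim; first exact: loc_bounded_measurable_slope.
  apply: loc_bounded_measurableM; last exact: loc_bounded_measurable_slope.
  apply: loc_bounded_measurable_continuous.
  exact: continuous_halfline_cst.
move=> t /andP[t0 tr]; apply: le_slope => // s /andP[s0 st].
by apply: FG; rewrite s0 (le_trans st).
Qed.

(** * Behaviour of u'/r up to the origin for continuous positive sources *)

Section Regularity.
Variable F : R -> R.
Hypotheses (cF : continuous_halfline F) (F_gt0 : pos_halfline F).

Let F_ge0 : nonneg_halfline F. Proof. by move=> r r0; rewrite ltW// F_gt0. Qed.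

Let hF : loc_bounded_measurable F. Proof. exact: loc_bounded_measurable_continuous. Qed.

Lemma is_derive_mass r : 0 < r -> is_derive r 1 (mass F) (Gplus N k a p r * F r).
Proof.
move=> r0; apply: is_derive_prim => //; first exact: loc_bounded_measurable_mass.
apply: continuous_halfline_at => //; apply: continuous_halflineM => //.
exact: continuous_Gplus.
Qed.

(* [quot F 0] is 0 by the convention x / 0 = 0; [quot_ext] takes the limit instead. *)
Definition quot_ext r := if r == 0 then p 0 * F 0 / (C0 N k * N%:R) else quot F r.

(** By the mean value theorem the mass is r times a positive value of its derivative. Positivity
    keeps the k-th root of [quot_ext] differentiable. *)
Lemma quot_ext_gt0 : pos_halfline quot_ext.
Proof.
move=> r r0; rewrite /quot_ext; case: eqVneq => [_|rn0].
  have N0 : 0 < N%:R :> R by rewrite ltr0n N_gt0.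
  by apply: divr_gt0; apply: mulr_gt0 => //; [exact: p_gt0|exact: F_gt0|exact: C0_gt0].
have {}r0 : 0 < r by rewrite lt_neqAle eq_sym rn0.
rewrite /quot divr_gt0 ?mulr_gt0 ?exprn_gt0 ?C0_gt0 ?intfactor_gt0//.
rewrite -[ltLHS](prim0 (fun t => Gplus N k a p t * F t)).
have md := is_derive_mass.
have [] := @MVT R (mass F) (fun t => Gplus N k a p t * F t) 0 r r0.
- by move=> x; rewrite in_itv/= => /andP[x0 _]; exact: md.
- apply: continuous_halfline_itv; apply: prim_continuous.
  exact: loc_bounded_measurable_mass.
move=> c; rewrite in_itv/= subr0 => /andP[c0 _] /eqP.
rewrite subr_eq => /eqP; rewrite -/(mass F r) => ->.
rewrite -/(mass F 0) ltrDr mulr_gt0// mulr_gt0 ?F_gt0 ?(ltW c0)//.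
by rewrite /Gplus !mulr_gt0 ?exprn_gt0 ?intfactor_gt0 ?p_gt0 ?(ltW c0).
Qed.

Lemma slope_quot_ext r : 0 <= r -> slope F r = r * kroot k (quot_ext r).
Proof.
move=> r0; rewrite slopeE// /quot_ext; case: eqVneq => [->|//].
by rewrite !mul0r.
Qed.

(** L'Hopital's rule for mass / r^N: after r^(N-1) cancels, the quotient of the derivatives is E p F
    / N, and E(0) = 1. *)
Lemma quot_cvg0 : quot F r @[r --> 0^'+] --> p 0 * F 0 / (C0 N k * N%:R).
Proof.
have -> : p 0 * F 0 / (C0 N k * N%:R) = (p 0 * F 0 / N%:R) / (1 * C0 N k).
  by field; rewrite (gt_eqF C0_gt0) pnatr_eq0 -lt0n N_gt0.
have E0 : intfactor N k a 0 = 1 by rewrite intfactorE prim0 expR0.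
have cE : intfactor N k a r @[r --> 0^'+] --> (1 : R).
  by rewrite -E0; exact: cvg_halfline_at_right0 continuous_intfactor.
suff H : mass F r / r ^+ N @[r --> 0^'+] --> p 0 * F 0 / N%:R.
  rewrite (_ : quot F = fun r => mass F r / r ^+ N / (intfactor N k a r * C0 N k)).
    apply: cvgM => //; apply: cvgV; first by rewrite mul1r (gt_eqF C0_gt0).
    by apply: cvgM => //; exact: cvg_cst.
  by apply/funext => r; rewrite /quot -!mulrA -!invfM !mulrA.
apply: (@lhopital_at_right R _ (fun t => Gplus N k a p t * F t) _
  (fun t => N%:R * t ^+ N.-1) 0 1) => //.
- by move=> x; rewrite in_itv/= => /andP[x0 _]; exact: is_derive_mass.
- by move=> x _; exact: is_derive_exprn.
- rewrite -[X in _ --> X](prim0 (fun t => Gplus N k a p t * F t)).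
  exact/cvg_halfline_at_right0/prim_continuous/loc_bounded_measurable_mass.
- rewrite [X in _ --> X](_ : _ = 0 ^+ N); last by rewrite expr0n eqn0Ngt N_gt0.
  apply: (@cvg_halfline_at_right0 _ (fun r => r ^+ N)).
  exact: continuous_halfline_exprn.
- move=> x; rewrite in_itv/= => /andP[x0 _].
  by rewrite mulf_neq0 ?expf_neq0 ?gt_eqF// ltr0n N_gt0.
- have cH : continuous_halfline (fun r => intfactor N k a r * p r * F r / N%:R).
    apply: continuous_halflineM; last exact: continuous_halfline_cst.
    apply: continuous_halflineM => //; apply: continuous_halflineM => //.
    exact: continuous_intfactor.
  have := cvg_halfline_at_right0 cH; rewrite E0 mul1r; apply: cvg_trans.
  apply: near_eq_cvg; near=> r.
  have r0 : 0 < r by [].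
  rewrite /Gplus; field.
  by rewrite expf_neq0 ?(gt_eqF r0)// pnatr_eq0 -lt0n N_gt0.
Unshelve. all: by end_near. Qed.

Lemma continuous_quot_ext : continuous_halfline quot_ext.
Proof.
apply/continuous_halflineP => x; have [->|x0] := eqVneq x 0.
  rewrite /continuous_at normr0; apply/cvgrPdist_le => e e0.
  have := quot_cvg0 => /cvgrPdist_le/(_ e e0).
  rewrite near_withinE => H.
  near=> y; rewrite /quot_ext eqxx normr_eq0; case: eqVneq => y0.
    by rewrite subrr normr0 ltW.
  have : 0 < `|y| by rewrite normr_gt0.
  near: y; move: H; rewrite -{1}(normr0 R); exact: norm_continuous.
have e y : y != 0 -> quot_ext `|y| = quot F `|y|.
  by move=> y0; rewrite /quot_ext normr_eq0 ifN.
rewrite /continuous_at e//; apply: cvg_trans (continuous_quot hF x0).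
apply: near_eq_cvg; near=> y; rewrite e//; near: y; exact: (cvgr_neq0 x).
Unshelve. all: by end_near. Qed.

(** r times the derivative of [quot_ext], in a form that makes sense at 0: the derivative of the
    mass contributes p F / C0, and that of 1 / (r^N E) contributes the factor -(N + r^k a / C0). *)
Definition quot_rate r :=
  p r * F r / C0 N k - (N%:R + r ^+ k * a r / C0 N k) * quot_ext r.

Lemma is_derive_quot r : 0 < r -> is_derive r 1 (quot F) (quot_rate r / r).
Proof.
move=> r0; have rn0 := gt_eqF r0.
have [C0n0 En0] : C0 N k != 0 :> R /\ intfactor N k a r != 0.
  by rewrite (gt_eqF C0_gt0) (gt_eqF (intfactor_gt0 _)).
have Dn0 : r ^+ N * intfactor N k a r * C0 N k != 0.
  by rewrite !mulf_neq0 ?expf_neq0 ?rn0.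
have dD := is_derive_mul (is_derive_mul (is_derive_exprn N r) (is_derive_intfactor r0))
  (is_derive_cst (C0 N k) r 1).
have dq := is_derive_mul (is_derive_mass r0) (@is_derive_inv _
  (fun y => y ^+ N * intfactor N k a y * C0 N k) r _ Dn0 dD).
apply: (is_derive_eq dq).
rewrite /quot_rate /quot_ext rn0 /quot /Gplus /density.
have -> : r ^+ N = r * r ^+ N.-1 by rewrite -exprS (prednK N_gt0).
have -> : r ^+ k = r * r ^+ k.-1 by rewrite -exprS (prednK k_gt0).
rewrite /=; field.
by rewrite C0n0 En0 expf_neq0 ?rn0.
Qed.

Lemma is_derive_quot_ext r : 0 < r -> is_derive r 1 quot_ext (quot_rate r / r).
Proof.
move=> r0; apply: near_eq_is_derive (is_derive_quot r0) => //.
near=> y; rewrite /quot_ext gt_eqF//; near: y; exact: lt_nbhsr.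
Unshelve. all: by end_near. Qed.

Definition slope_ratio r := kroot k (quot_ext r).

(* r times the derivative of [slope_ratio], but also meaningful at 0. *)
Definition slope_ratio_rate r := k%:R^-1 * slope_ratio r / quot_ext r * quot_rate r.

Lemma continuous_slope_ratio : continuous_halfline slope_ratio.
Proof.
apply: continuous_halfline_comp; [exact: continuous_kroot|exact: continuous_quot_ext|].
by move=> r r0; rewrite ltW// quot_ext_gt0.
Qed.

Lemma is_derive_slope_ratio r : 0 < r ->
  is_derive r 1 slope_ratio (slope_ratio_rate r / r).
Proof.
move=> r0; rewrite /slope_ratio_rate -mulrA.
apply: is_derive1_comp; last exact: is_derive_quot_ext.
by apply: is_derive_kroot; rewrite quot_ext_gt0// ltW.
Qed.

(** With p(0) F(0) / (C0 N) as value of [quot_ext], the two terms of [quot_rate] cancel at 0. This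
    cancellation is what makes the Hessian continuous at the origin. *)
Lemma slope_ratio_rate0 : slope_ratio_rate 0 = 0.
Proof.
rewrite /slope_ratio_rate /quot_rate /quot_ext eqxx expr0n eqn0Ngt k_gt0 !mul0r addr0.
rewrite [X in _ * X](_ : _ = 0) ?mulr0//.
by field; rewrite (gt_eqF C0_gt0) pnatr_eq0 -lt0n N_gt0.
Qed.

Lemma continuous_slope_ratio_rate : continuous_halfline slope_ratio_rate.
Proof.
have cst_c := @continuous_halfline_cst R.
have cexp := @continuous_halfline_exprn R.
have cV : continuous_halfline (fun r => (quot_ext r)^-1).
  apply/continuous_halflineP => x.
  apply: cvgV; last exact/cvg_halfline/continuous_quot_ext.
  by rewrite gt_eqF// quot_ext_gt0.
have cN f : continuous_halfline f -> continuous_halfline (fun r => - f r).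
  move=> cf; apply: (@eq_continuous_halfline _ (fun r => -1 * f r)).
    by move=> r _; rewrite mulN1r.
  exact: continuous_halflineM.
apply: continuous_halflineM.
  apply: continuous_halflineM => //; apply: continuous_halflineM => //.
  exact: continuous_slope_ratio.
apply: continuous_halflineD.
  by apply: continuous_halflineM => //; exact: continuous_halflineM.
apply: cN; apply: continuous_halflineM; last exact: continuous_quot_ext.
apply: continuous_halflineD => //; apply: continuous_halflineM => //.
exact: continuous_halflineM.
Qed.

(** This identity and the next show the origin of [C0]: the coefficients of g^k and g^(k-1) s in S_k
    are N C0 and k C0. The N matches the exponent of r^N in [quot], and the k cancels the 1/k from
    differentiating the root. *)
Lemma natr_binE : 'C(N, k)%:R = C0 N k * N%:R :> R.
Proof.
have d0 : (k`! * (N - k)`!)%:R != 0 :> R by rewrite pnatr_eq0 -lt0n muln_gt0 !fact_gt0.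
apply: (mulIf d0); rewrite -natrM bin_fact// /C0 mulrAC divfK// -natrM mulnC.
by rewrite -{1}(prednK N_gt0) factS (prednK N_gt0).
Qed.

Lemma natr_bin_predE : 'C(N.-1, k.-1)%:R = C0 N k * k%:R :> R.
Proof.
have d0 : (k`! * (N - k)`!)%:R != 0 :> R by rewrite pnatr_eq0 -lt0n muln_gt0 !fact_gt0.
apply: (mulIf d0); rewrite -natrM /C0 mulrAC divfK// -natrM; congr (_%:R).
have H n m : (m <= n)%N -> ('C(n, m) * (m.+1`! * (n.+1 - m.+1)`!) = n`! * m.+1)%N.
  move=> mn; rewrite subSS -(bin_fact mn) factS -[RHS]mulnA; congr muln.
  by rewrite [RHS]mulnC mulnA.
have := H N.-1 k.-1; rewrite !prednK ?N_gt0//; apply.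
by rewrite -ltnS !prednK// N_gt0.
Qed.

(** With q = g^k, differentiating the root gives g^(k-1) s = [quot_rate] / k. The left side becomes
    C0 (N q + [quot_rate]) + a r^k q, and the definition of [quot_rate] leaves p F. *)
Lemma slope_ratio_equation r : 0 <= r ->
  'C(N, k)%:R * slope_ratio r ^+ k +
  'C(N.-1, k.-1)%:R * (slope_ratio r ^+ k.-1 * slope_ratio_rate r) +
  a r * (r * slope_ratio r) ^+ k = p r * F r.
Proof.
move=> r0; have q0 := quot_ext_gt0 r0; have C0n0 := gt_eqF C0_gt0.
have qk : slope_ratio r ^+ k = quot_ext r by rewrite krootK// ltW.
have kn0 : k%:R != 0 :> R by rewrite pnatr_eq0 -lt0n.
have -> : slope_ratio r ^+ k.-1 * slope_ratio_rate r = k%:R^-1 * quot_rate r.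
  have -> : slope_ratio r ^+ k.-1 * slope_ratio_rate r =
      k%:R^-1 * (slope_ratio r ^+ k.-1 * slope_ratio r) / quot_ext r * quot_rate r.
    by rewrite /slope_ratio_rate; field; rewrite kn0 (gt_eqF q0).
  by rewrite -exprSr (prednK k_gt0) qk mulfK// (gt_eqF q0).
rewrite exprMn qk natr_binE natr_bin_predE /quot_rate.
by field; rewrite C0n0 kn0.
Qed.

End Regularity.

End Operator.

(** * Radial functions and their Hessian *)

Section HalfLineDerivative.
Context {R : realType}.
Implicit Types (f d : R -> R).

(** By the mean value theorem a difference quotient at r is d(c) with c between r and s, and [d] is
    continuous. This includes r = 0, where no derivative is assumed. *)
Lemma has_deriv_halfline_is_derive f d : continuous_halfline f ->
  continuous_halfline d -> (forall r : R, 0 < r -> is_derive r 1 f (d r)) ->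
  has_deriv_halfline f d.
Proof.
move=> cf cd df r r0.
have mvt x y : 0 <= x -> x < y -> exists2 c : R, x < c < y & f y - f x = d c * (y - x).
  move=> x0 xy; have [||c] := @MVT R f d x y xy.
  - move=> z; rewrite in_itv/= => /andP[xz _]; apply: df.
    exact: le_lt_trans xz.
  - apply: continuous_subspaceW cf => z /=; rewrite in_itv/= => /andP[xz _].
    exact: le_trans xz.
  - by rewrite in_itv/=; exists c.
apply/cvgrPdist_le => e e0.
have /cvgrPdist_le/(_ e e0) := @cvg_halfline _ _ r cd.
move=> /nbhs_ballP[dl /= dl0 hd].
rewrite near_withinE near_withinE; near=> s => s_neq_r s0.
have sr : `|s - r| < dl.
  by rewrite distrC; near: s; apply/nbhs_ballP; exists dl.
have close c : 0 <= c -> `|c - r| < dl -> `|d r - d c| <= e.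
  move=> c0 cr; have := hd c; rewrite /ball/= (ger0_norm r0) (ger0_norm c0); apply.
  by rewrite distrC.
have [rs|rs|] := ltgtP r s; last by move=> rs; rewrite rs eqxx in s_neq_r.
- have [c /andP[rc cs] ->] := mvt r s r0 rs.
  rewrite mulfK ?subr_eq0//; apply: close; first by rewrite (le_trans r0)// ltW.
  by rewrite (le_lt_trans _ sr)// !gtr0_norm ?subr_gt0// lerD2r ltW.
- have [c /andP[sc cr] H] := mvt s r s0 rs.
  rewrite -[f s - f r]opprB -[s - r]opprB invrN mulrNN H mulfK ?subr_eq0 1?eq_sym//.
  apply: close; first by rewrite (le_trans s0)// ltW.
  rewrite (le_lt_trans _ sr)// ![`|_ - r|]distrC !gtr0_norm ?subr_gt0//.
  by rewrite lerD2l lerN2 ltW.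
Unshelve. all: by end_near. Qed.

End HalfLineDerivative.

(** * Directional derivatives as derivatives along lines *)

Section Slices.
Context {R : realType} {V : normedModType R}.
Implicit Types (F D : V -> R) (x v : V).

Lemma is_derive_slice F x v (h d : R) : is_derive (h *: v + x) v F d ->
  is_derive h 1 (fun t : R => F (t *: v + x)) d.
Proof.
move=> [dF <-].
have e : (fun k : R => k^-1 *: (((fun t : R => F (t *: v + x)) \o shift h) (k *: 1)
    - F (h *: v + x))) =
    (fun k : R => k^-1 *: ((F \o shift (h *: v + x)) (k *: v) - F (h *: v + x))).
  by apply/funext => k /=; rewrite /shift/= [k *: 1]mulr1 scalerDl addrA.
by split; rewrite /derivable ?/derive e.
Qed.

Lemma is_derive_unslice F x v d : is_derive (0 : R) 1 (fun t : R => F (t *: v + x)) d ->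
  is_derive x v F d.
Proof.
move=> [dF <-].
have e : (fun k : R => k^-1 *: (((fun t : R => F (t *: v + x)) \o shift 0) (k *: 1)
    - F (0 *: v + x))) =
    (fun k : R => k^-1 *: ((F \o shift x) (k *: v) - F x)).
  by apply/funext => k /=; rewrite /shift/= [k *: 1]mulr1 addr0 scale0r add0r.
by split; rewrite /derivable ?/derive -e.
Qed.

Lemma is_derive_chain F (f : R -> R) x v (d e : R) :
  is_derive (F x) 1 f e -> is_derive x v F d ->
  is_derive x v (f \o F) (e * d).
Proof.
move=> df dF; apply: is_derive_unslice.
apply: (@is_derive1_comp _ f (fun t : R => F (t *: v + x))).
  by rewrite scale0r add0r.
by apply: is_derive_slice; rewrite scale0r add0r.
Qed.

(** On the line t v, the condition [v != 0] keeps every t != 0 away from the origin, so the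
    one-dimensional statement applies. *)
Lemma is_derive_removable0 F D v : v != 0 -> {for 0, continuous F} ->
  {for 0, continuous D} -> (forall x, x != 0 -> is_derive x v F (D x)) ->
  is_derive 0 v F (D 0).
Proof.
move=> v0 cF cD dF; apply: is_derive_unslice.
have cs G : {for 0, continuous G} ->
    {for 0, continuous (fun t : R => G (t *: v + 0) : R)}.
  move=> cG; apply: continuous_comp; last by rewrite scale0r add0r.
  by apply: cvgD; [apply: cvgZr_tmp; exact: cvg_id|exact: cvg_cst].
rewrite (_ : D 0 = D (0 *: v + 0)); last by rewrite scale0r add0r.
apply: (@is_derive_removable _ _ (fun t : R => D (t *: v + 0))); [exact: cs..|].
move=> t t0; apply: is_derive_slice; apply: dF.
by rewrite addr0 scaler_eq0 negb_or t0.
Qed.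

End Slices.

Lemma continuous_at_squeeze {R : realType} {T : topologicalType} (F G : T -> R) (x : T) :
  {for x, continuous G} -> F x = 0 -> G x = 0 -> (forall y, `|F y| <= `|G y|) ->
  {for x, continuous F}.
Proof.
rewrite /prop_for /continuous_at => + F0 G0 FG; rewrite F0 G0 => cG.
apply/cvgrPdist_le => e e0; have /cvgrPdist_le/(_ e e0) := cG.
by apply: filterS => y; rewrite !sub0r !normrN; exact: le_trans.
Qed.

Section Radial.
Context {R : realType} {N : nat}.
Implicit Types (x y : 'rV[R]_N) (f : R -> R).

Lemma enorm_ge0 x : 0 <= enorm x.
Proof. exact: sqrtr_ge0. Qed.

Lemma enorm_sqr x : enorm x ^+ 2 = \sum_(i < N) x ord0 i ^+ 2.
Proof. by rewrite sqr_sqrtr// sumr_ge0// => i _; exact: sqr_ge0. Qed.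

Lemma enorm0 : enorm (0 : 'rV[R]_N) = 0.
Proof.
rewrite /enorm big1 ?sqrtr0// => i _; by rewrite mxE expr0n.
Qed.

Lemma enorm_eq0 x : (enorm x == 0) = (x == 0).
Proof.
apply/eqP/eqP => [x0|->]; last exact: enorm0.
apply/rowP => i; rewrite mxE; apply/eqP; rewrite -sqrf_eq0.
have /eqP : \sum_(i < N) x ord0 i ^+ 2 = 0 by rewrite -enorm_sqr x0 expr0n.
rewrite psumr_eq0; last by move=> j _; exact: sqr_ge0.
by move=> /allP/(_ i); rewrite mem_index_enum => /(_ isT).
Qed.

Lemma ler_coord_enorm x i : `|x ord0 i| <= enorm x.
Proof.
rewrite -(@ler_pXn2r _ 2)// ?nnegrE ?enorm_ge0// enorm_sqr real_normK ?num_real//.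
by rewrite (bigD1 i)//= lerDl sumr_ge0// => j _; exact: sqr_ge0.
Qed.

Lemma continuous_coord i : continuous (fun x => x ord0 i).
Proof. exact: coord_continuous. Qed.

Lemma continuous_atM (F G : 'rV[R]_N -> R) x : {for x, continuous F} ->
  {for x, continuous G} -> {for x, continuous (fun y => F y * G y)}.
Proof. exact: continuousM. Qed.

Lemma continuous_atD (F G : 'rV[R]_N -> R) x : {for x, continuous F} ->
  {for x, continuous G} -> {for x, continuous (fun y => F y + G y)}.
Proof. exact: continuousD. Qed.

Lemma continuous_atV (F : 'rV[R]_N -> R) x : F x != 0 -> {for x, continuous F} ->
  {for x, continuous (fun y => (F y)^-1)}.
Proof. exact: continuousV. Qed.

Lemma continuous_enorm : continuous (@enorm R N).
Proof.
move=> x; apply: continuous_comp; last exact: sqrt_continuous.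
apply: (@cvg_big _ _ +%R 0); [exact: add_continuous|exact: nbhs_filter|move=> i _].
apply: (@continuous_comp _ _ _ (fun y : 'rV[R]_N => y ord0 i) (fun r : R => r ^+ 2)).
  exact: continuous_coord.
exact: exprn_continuous.
Qed.

Lemma continuous_radial f : continuous_halfline f ->
  continuous (fun x => f (enorm x)).
Proof.
move=> cf x; rewrite /continuous_at /=.
rewrite (_ : (fun x => _) = (fun r => f `|r|) \o @enorm R N); last first.
  by apply/funext => y /=; rewrite ger0_norm// enorm_ge0.
rewrite -[X in f X]ger0_norm ?enorm_ge0//.
apply: continuous_comp; first exact: continuous_enorm.
exact: cvg_halfline.
Qed.

Lemma is_derive_coord x i j :
  is_derive x (delta_mx ord0 i) (fun y : 'rV[R]_N => y ord0 j) (i == j)%:R.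
Proof.
apply: is_derive_unslice.
rewrite (_ : (fun t : R => _) = (fun t => t * (i == j)%:R + x ord0 j)); last first.
  by apply/funext => t; rewrite !mxE eqxx/= eq_sym.
have := is_deriveD (is_derive_mul (is_derive_id (0 : R) 1)
  (is_derive_cst ((i == j)%:R : R) (0 : R) 1)) (is_derive_cst (x ord0 j) (0 : R) 1).
by rewrite mul1r mul0r !addr0.
Qed.

Lemma is_derive_enorm x i : x != 0 ->
  is_derive x (delta_mx ord0 i) (@enorm R N) (x ord0 i / enorm x).
Proof.
move=> x0; have ex0 : 0 < enorm x by rewrite lt_neqAle eq_sym enorm_eq0 x0 enorm_ge0.
have s0 : 0 < \sum_(i < N) x ord0 i ^+ 2 by rewrite -enorm_sqr exprn_gt0.
have ds : is_derive x (delta_mx ord0 i) (fun y : 'rV[R]_N => \sum_(j < N) y ord0 j ^+ 2)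
    (2 * x ord0 i).
  have dc j := is_derive_chain (is_derive_exprn 2 (x ord0 j)) (is_derive_coord x i j).
  have := is_derive_sum dc; rewrite fct_sumE (bigD1 i)//= eqxx mulr1 big1 ?addr0//.
  by move=> j ji; rewrite eq_sym (negbTE ji) mulr0.
have := is_derive_chain (is_derive1_sqrt s0) ds.
rewrite -/(enorm x) invfM mulrACA mulVf ?mul1r// mulrC; exact.
Qed.

(** * Radial functions with u' = r g and r g' = s *)

Section Solution.
Variables (u g s : R -> R).
Hypotheses (cu : continuous_halfline u) (cg : continuous_halfline g).
Hypotheses (cs : continuous_halfline s) (s0 : s 0 = 0).
Hypothesis du : forall r : R, 0 < r -> is_derive r 1 u (r * g r).
Hypothesis dg : forall r : R, 0 < r -> is_derive r 1 g (s r / r).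

Let U x := u (enorm x).

Lemma C2_halfline_radial : C2_halfline u.
Proof.
have cid : continuous_halfline (id : R -> R) by apply: continuous_halflineW => x.
have crg : continuous_halfline (fun r => r * g r) by exact: continuous_halflineM.
exists (fun r => r * g r), (fun r => g r + s r); split.
- exact: has_deriv_halfline_is_derive.
- apply: has_deriv_halfline_is_derive => //; first exact: continuous_halflineD.
  move=> r r0; have := is_derive_mul (is_derive_id r 1) (dg r0).
  by rewrite mul1r mulrC divfK ?gt_eqF.
- exact: continuous_halflineD.
Qed.

Lemma delta_mx_neq0 i : delta_mx ord0 i != 0 :> 'rV[R]_N.
Proof.
apply/eqP => /rowP/(_ i); rewrite !mxE !eqxx => /eqP.
by rewrite oner_eq0.
Qed.

Let pos_enorm x : x != 0 -> 0 < enorm x.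
Proof. by move=> x0; rewrite lt_neqAle eq_sym enorm_eq0 x0 enorm_ge0. Qed.

(** The chain rule away from 0 gives r g(r) x_i / r; once r is cancelled the formula has no division
    and extends to the origin by continuity. *)
Lemma is_derive_radial i x :
  is_derive x (delta_mx ord0 i) U (g (enorm x) * x ord0 i).
Proof.
pose D y := g (enorm y) * y ord0 i.
have dU y : y != 0 -> is_derive y (delta_mx ord0 i) U (D y).
  move=> y0; have e0 := pos_enorm y0.
  apply: is_derive_eq; first exact: is_derive_chain (du e0) (is_derive_enorm i y0).
  by rewrite /D; field; rewrite gt_eqF.
have [->|x0] := eqVneq x 0; last exact: dU.
apply: (@is_derive_removable0 _ _ U D) dU; first exact: delta_mx_neq0.
  exact: (continuous_radial cu).
apply: continuous_atM; first exact: (continuous_radial cg).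
exact: continuous_coord.
Qed.

Let hess i j x :=
  s (enorm x) / enorm x ^+ 2 * x ord0 i * x ord0 j + g (enorm x) * (i == j)%:R.

Lemma continuous_hess i j : continuous (hess i j).
Proof.
move=> x; apply: continuous_atD; last first.
  by apply: continuous_atM; [exact: (continuous_radial cg)|exact: cst_continuous].
have [->|x0] := eqVneq x 0.
  have coord0 l : (0 : 'rV[R]_N) ord0 l = 0 by rewrite mxE.
  (* Since |x_i| and |x_j| are at most |x|, the rank one term is at most |s(|x|)|, which tends to
     s(0) = 0. *)
  apply: (@continuous_at_squeeze _ _ _ (fun y => s (enorm y))) => [|||y].
  - exact: (continuous_radial cs).
  - by rewrite !coord0 !mulr0.
  - by rewrite enorm0.
  have [->|y0] := eqVneq y 0; first by rewrite !coord0 !mulr0 normr0.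
  have ey := pos_enorm y0.
  rewrite -!mulrA normrM ler_piMr// !normrM normfV.
  rewrite [X in X^-1]ger0_norm ?sqr_ge0// mulrC ler_pdivrMr ?exprn_gt0// mul1r expr2.
  by apply: ler_pM => //; exact: ler_coord_enorm.
apply: continuous_atM; last exact: continuous_coord.
apply: continuous_atM; last exact: continuous_coord.
apply: continuous_atM; first exact: (continuous_radial cs).
apply: continuous_atV; first by rewrite expf_neq0// gt_eqF// pos_enorm.
apply: (@continuous_comp _ _ _ (@enorm R N) (fun r : R => r ^+ 2)).
  exact: continuous_enorm.
exact: exprn_continuous.
Qed.

Lemma is_derive_radial2 i j x :
  is_derive x (delta_mx ord0 i) (fun y => g (enorm y) * y ord0 j) (hess i j x).
Proof.
have dU y : y != 0 ->
    is_derive y (delta_mx ord0 i) (fun y => g (enorm y) * y ord0 j) (hess i j y).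
  move=> y0; have e0 := pos_enorm y0.
  apply: is_derive_eq.
    exact: is_deriveM (is_derive_chain (dg e0) (is_derive_enorm i y0))
      (is_derive_coord y i j).
  rewrite /hess /= /GRing.scale /=; field.
  by rewrite gt_eqF.
have [->|x0] := eqVneq x 0; last exact: dU.
apply: (@is_derive_removable0 _ _ _ (hess i j)) dU; first exact: delta_mx_neq0.
  apply: continuous_atM; first exact: (continuous_radial cg).
  exact: continuous_coord.
exact: continuous_hess.
Qed.

Lemma partial_radial i : partial i U = fun x => g (enorm x) * x ord0 i.
Proof.
by apply/funext => x; exact: (@derive_val _ _ _ _ _ _ _ (is_derive_radial i x)).
Qed.

Lemma partial2_radial i j : partial i (partial j U) = hess i j.
Proof.
rewrite partial_radial; apply/funext => x.
exact: (@derive_val _ _ _ _ _ _ _ (is_derive_radial2 i j x)).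
Qed.

Lemma C2_space_radial : C2_space U.
Proof.
split.
- exact: (continuous_radial cu).
- by move=> i x; have [] := is_derive_radial i x.
- move=> i; rewrite partial_radial => x.
  by apply: continuous_atM; [exact: (continuous_radial cg)|exact: continuous_coord].
- by move=> i j x; rewrite partial_radial; have [] := is_derive_radial2 i j x.
- by move=> i j; rewrite partial2_radial; exact: continuous_hess.
Qed.

Lemma enorm_grad_radial x : 0 <= g (enorm x) -> enorm (grad U x) = enorm x * g (enorm x).
Proof.
move=> g0; rewrite /enorm; under eq_bigr do rewrite mxE partial_radial exprMn.
by rewrite -mulr_sumr sqrtrM ?sqr_ge0// sqrtr_sqr ger0_norm// mulrC.
Qed.

Lemma hessian_radial x : hessian U x = \matrix_(i, j)
  (s (enorm x) / enorm x ^+ 2 * x ord0 i * x ord0 j + g (enorm x) * (i == j)%:R).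
Proof. by apply/matrixP => i j; rewrite !mxE partial2_radial. Qed.

End Solution.

End Radial.

(** * The k-Hessian of a scalar matrix plus a rank one matrix *)

Section RankOne.
Context {R : realType}.

(** The bordered matrix [B] is factored in two ways, eliminating one or the other off-diagonal
    block; comparing determinants gives the formula. *)
Lemma det_scalar_add_rank1 n (g c : R) (v : 'rV[R]_n) : g != 0 ->
  \det (g%:M + c *: (v^T *m v)) = g ^+ n * (1 + c / g * (v *m v^T) ord0 ord0).
Proof.
move=> g0; pose B := block_mx (1%:M : 'M[R]_1) ((- c) *: v) v^T (g%:M : 'M[R]_n).
have <- : \det B = \det (g%:M + c *: (v^T *m v)).
  have -> : B = block_mx (1%:M : 'M[R]_1) 0 v^T 1%:M *m
      block_mx 1%:M ((- c) *: v) 0 (g%:M + c *: (v^T *m v)).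
    rewrite mulmx_block !(mul1mx, mul0mx, mulmx0, mulmx1, addr0) -scalemxAr scaleNr.
    by rewrite scaleNr addrCA addNr addr0 -scaleNr.
  by rewrite det_mulmx det_lblock det_ublock !det1 !mul1r.
have -> : B = block_mx (1%:M : 'M[R]_1) ((- (c / g)) *: v) 0 1%:M *m
    block_mx (1%:M + (c / g) *: (v *m v^T)) 0 v^T g%:M.
  rewrite mulmx_block !(mul1mx, mul0mx, mulmx0, add0r) -!scalemxAl scaleNr addrK.
  by rewrite mul_mx_scalar scalerA mulNr divfK.
rewrite det_mulmx det_lblock det_ublock !det1 !mul1r det_scalar mulrC; congr (_ * _).
by rewrite det_mx11 !mxE.
Qed.

(** Each principal minor has the same form, with x restricted to [I]. In the sum, x_i^2 is counted
    once for every k-subset containing i. *)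
Lemma Sk_scalar_add_rank1 N k (g c : R) (x : 'rV[R]_N) :
  (0 < k)%N -> (k <= N)%N -> g != 0 ->
  Sk k (\matrix_(i, j) (c * x ord0 i * x ord0 j + g * (i == j)%:R)) =
  'C(N, k)%:R * g ^+ k + 'C(N.-1, k.-1)%:R * (g ^+ k.-1 * (c * \sum_i x ord0 i ^+ 2)).
Proof.
move=> k0 kN g0; rewrite /Sk.
have detI (I : {set 'I_N}) : #|I| == k ->
    \det (\matrix_(i < #|I|, j < #|I|)
      (\matrix_(i, j) (c * x ord0 i * x ord0 j + g * (i == j)%:R))
        (enum_val i) (enum_val j)) =
    g ^+ k + g ^+ k.-1 * c * \sum_(i in I) x ord0 i ^+ 2.
  move=> /eqP Ik.
  pose v : 'rV[R]_#|I| := \row_i x ord0 (enum_val i).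
  rewrite (_ : \matrix_(i, j) _ = g%:M + c *: (v^T *m v)); last first.
    apply/matrixP => i j; rewrite !mxE big_ord1 !mxE (inj_eq enum_val_inj).
    by rewrite addrC mulr_natr mulrA.
  have vv : (v *m v^T) ord0 ord0 = \sum_(i in I) x ord0 i ^+ 2.
    rewrite mxE (big_enum_val (fun i => x ord0 i ^+ 2)).
    by apply: eq_bigr => i _; rewrite !mxE -expr2.
  rewrite det_scalar_add_rank1// vv Ik -(prednK k0) exprSr /=.
  by field.
under eq_bigr => I Ik do rewrite detI//.
rewrite big_split/= -mulr_sumr; congr (_ + _).
  rewrite sumr_const mulr_natl; congr (_ *+ _).
  by rewrite -[in RHS](card_ord N) -card_draws cardsE.
rewrite (exchange_big_dep xpredT)//=.
(* Counted through the complement: C(N-1, k) of the k-subsets avoid i, and Pascal's rule gives the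
   rest. *)
have cardi (i : 'I_N) :
    #|[pred I : {set 'I_N} | (#|I| == k) && (i \in I)]| = 'C(N.-1, k.-1).
  have N0 : (0 < N)%N by exact: leq_trans kN.
  have e0 := card_draws 'I_N k; have e1 := cards_draws [set~ i] k.
  rewrite card_ord in e0; rewrite cardsC1 card_ord in e1.
  have := cardsID [set I : {set 'I_N} | i \in I] [set I : {set 'I_N} | #|I| == k].
  rewrite e0 (_ : #|_ :\: _| = 'C(N.-1, k)); last first.
    rewrite -e1; apply: eq_card => I; rewrite !inE; congr (_ && _).
    by rewrite [RHS]finset.subsetC finset.sub1set finset.inE.
  have -> : 'C(N, k) = ('C(N.-1, k.-1) + 'C(N.-1, k))%N.
    by case: (N) N0 => // n _; case: (k) k0 => // l _; rewrite binS addnC.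
  move=> /addIn <-.
  by apply: eq_card => I; rewrite !inE.
under eq_bigr do rewrite sumr_const cardi -mulr_natl.
by rewrite -mulr_sumr; ring.
Qed.

End RankOne.

(** * Fixed points and their growth *)

Section LimitsAtInfinity.
Context {R : realType}.
Implicit Types (u v : R -> R).

Lemma nondecreasing_le_lim u : nondecreasing_halfline u -> lim_finite u ->
  forall r : R, 0 <= r -> u r <= lim (u x @[x --> +oo]).
Proof.
move=> nu cu r r0; apply: limr_ge => //.
by near=> x; apply: nu => //; near: x; apply: nbhs_pinfty_ge; rewrite num_real.
Unshelve. all: by end_near. Qed.

Lemma lim_finite_bounded u (B : R) : nondecreasing_halfline u ->
  (forall r : R, 0 <= r -> u r <= B) -> lim_finite u.
Proof.
(* [u] is monotone only on the half-line; freezing it below 0 gives a function monotone on R with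
   the same behaviour at infinity. *)
move=> nu uB; pose v r := u (Num.max 0 r).
have cv : v r @[r --> +oo] --> sup (range v).
  apply: nondecreasing_cvgr.
    move=> x y xy; apply: nu; first by rewrite le_max lexx.
    by rewrite ge_max !le_max lexx/= xy orbT.
  by exists B => _ [x _ <-]; apply: uB; rewrite le_max lexx.
apply/cvg_ex; exists (sup (range v)); apply: cvg_trans cv; apply: near_eq_cvg.
near=> r; rewrite /v max_r//; near: r; apply: nbhs_pinfty_ge; rewrite num_real//.
Unshelve. all: by end_near. Qed.

Lemma lim_infinite_ge u v (c d : R) : 0 < c ->
  (forall r : R, 0 <= r -> d + c * v r <= u r) -> lim_infinite v -> lim_infinite u.
Proof.
move=> c0 vu /cvgryPge hv; apply/cvgryPge => A.
have := hv ((A - d) / c); apply: filterS2; last first.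
  by apply: (@nbhs_pinfty_ge R 0); rewrite num_real.
move=> r r0 /=; rewrite ler_pdivrMr// => H.
by apply: le_trans (vu r r0); rewrite -lerBlDl mulrC.
Qed.

End LimitsAtInfinity.

(** * One equation of the system as an order-preserving integral operator *)

Section Shooting.
Context {R : realType}.
Implicit Types (a p f v w : R -> R) (c r t : R).

Definition coefficients (N k : nat) a p : Prop :=
  [/\ (0 < k <= N)%N, continuous_halfline a, nonneg_halfline a,
      continuous_halfline p & pos_halfline p].

Definition source f : Prop :=
  [/\ continuous_halfline f, nonneg_halfline f, nondecreasing_halfline f
    & forall s, 0 < s -> 0 < f s].

(** The ordered set on which the operators act: monotonicity makes f(v) an admissible source, and c
    > 0 keeps the argument of f positive. *)
Definition increasing_above c v : Prop :=
  nondecreasing_halfline v /\ forall r, 0 <= r -> c <= v r.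

(** Integral form of one radial equation with central value [c], the other unknown [v] being
    given. *)
Definition shoot N k a p f c v r := c + rise N k a p (fun t => f (v t)) r.

Lemma loc_bounded_measurable_cst c : loc_bounded_measurable (fun=> c : R).
Proof.
exact/loc_bounded_measurable_continuous/continuous_halfline_cst.
Qed.

Lemma source_comp f c v : source f -> 0 < c -> increasing_above c v ->
  nonneg_halfline (fun t => f (v t)) /\ nondecreasing_halfline (fun t => f (v t)).
Proof.
move=> [_ f0 fnd _] c0 [nv cv]; split.
  by move=> r r0; apply: f0; apply: le_trans (cv _ r0); exact: ltW.
move=> r s r0 rs; apply: fnd; last exact: nv.
by apply: le_trans (cv _ r0); exact: ltW.
Qed.

Lemma shoot_increasing_above N k a p f c d v : coefficients N k a p -> source f ->
  0 < d -> increasing_above d v -> increasing_above c (shoot N k a p f c v).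
Proof.
move=> [/andP[k0 kN] ca a0 cp p0] sf d0 hv.
have [fv0 fvnd] := source_comp sf d0 hv.
split; last by move=> r _; rewrite lerDl rise_ge0.
move=> r s r0 rs; rewrite lerD2l; apply: rise_nondecreasing => //.
exact: loc_bounded_measurable_nondecreasing.
Qed.

Lemma continuous_shoot N k a p f c d v : coefficients N k a p -> source f ->
  0 < d -> increasing_above d v -> continuous_halfline (shoot N k a p f c v).
Proof.
move=> [/andP[k0 kN] ca a0 cp p0] sf d0 hv.
have [fv0 fvnd] := source_comp sf d0 hv.
apply: continuous_halflineD; first exact: continuous_halfline_cst.
apply: continuous_rise => //.
exact: loc_bounded_measurable_nondecreasing.
Qed.

Lemma le_shoot N k a p f c d v w r : coefficients N k a p -> source f ->
  0 < d -> increasing_above d v -> increasing_above d w ->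
  (forall t, 0 <= t <= r -> v t <= w t) ->
  shoot N k a p f c v r <= shoot N k a p f c w r.
Proof.
move=> [/andP[k0 kN] ca a0 cp p0] sf d0 hv hw vw.
have [fv0 fvnd] := source_comp sf d0 hv; have [fw0 fwnd] := source_comp sf d0 hw.
rewrite lerD2l -[leRHS]mul1r -(kroot1 k).
apply: le_rise => //; try exact: loc_bounded_measurable_nondecreasing.
move=> t /[dup] tr /andP[t0 _]; rewrite mul1r.
case: sf => _ _ fnd _; apply: fnd; last exact: vw.
by apply: le_trans (hv.2 _ t0); exact: ltW.
Qed.

(** The integrals see only [0, oo), so agreement there yields equality on all of R. This turns a
    fixed point on the half-line into an equation between functions. *)
Lemma eq_shoot N k a p f c v w : (forall t, 0 <= t -> v t = w t) ->
  shoot N k a p f c v = shoot N k a p f c w.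
Proof.
move=> vw; apply/funext => r; rewrite /shoot /rise.
apply: (congr1 (fun z => c + z)); apply: eq_prim => y _; rewrite /slope /mass.
apply: (congr1 (fun z => kroot k (Gminus N k a y * z))).
by apply: eq_prim => t /andP[t0 _]; rewrite vw.
Qed.

(** [Q] is the response to the constant source 1. Likewise [P] unfolds to [rise] with source phi(1 +
    Q), which later steps use by conversion. *)
Lemma Q_rise N k a p r : Q N k a p r = rise N k a p (fun=> 1) r.
Proof.
rewrite /Q /rise /prim; apply: eq_Rintegral => z _; congr (kroot k (_ * _)).
by apply: eq_Rintegral => t _; rewrite mulr1.
Qed.

Lemma Q_ge0 N k a p r : 0 <= Q N k a p r.
Proof. by rewrite Q_rise rise_ge0. Qed.

Lemma continuous_Q N k a p : coefficients N k a p -> continuous_halfline (Q N k a p).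
Proof.
move=> [/andP[k0 kN] ca a0 cp p0]; rewrite (_ : Q N k a p = rise N k a p (fun=> 1)).
  apply: continuous_rise => //.
  exact: loc_bounded_measurable_cst.
by apply/funext => r; exact: Q_rise.
Qed.

Lemma continuous_phiQ N k a p (phi : R -> R) : coefficients N k a p ->
  continuous_halfline phi -> continuous_halfline (fun t => phi (1 + Q N k a p t)).
Proof.
move=> hc cphi; apply: (@continuous_halfline_comp _ phi (fun t => 1 + Q N k a p t)) => //.
  apply: continuous_halflineD; last exact: continuous_Q.
  exact: continuous_halfline_cst.
by move=> r _; rewrite addr_ge0// Q_ge0.
Qed.

Lemma ge_rise N k a p c (F G : R -> R) r : coefficients N k a p -> 0 < c ->
  nonneg_halfline F -> nonneg_halfline G ->
  loc_bounded_measurable F -> loc_bounded_measurable G ->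
  (forall t, 0 <= t <= r -> c * G t <= F t) ->
  kroot k c * rise N k a p G r <= rise N k a p F r.
Proof.
move=> [/andP[k0 kN] ca a0 cp p0] c0 F0 G0 hF hG GF.
have /(ler_wpM2l (kroot_ge0 k c)) : rise N k a p G r <= kroot k c^-1 * rise N k a p F r.
  apply: le_rise => //; first by rewrite invr_ge0 ltW.
  by move=> t tr; rewrite mulrC ler_pdivlMr// mulrC; exact: GF.
move=> /le_trans; apply; rewrite mulrA -krootM ?invr_ge0 ?(ltW c0)//.
by rewrite mulfV ?gt_eqF// kroot1 mul1r.
Qed.

End Shooting.

Section Bounds.
Context {R : realType}.
Variables (N k1 k2 : nat) (alpha beta : R) (a1 a2 p1 p2 f1 f2 : R -> R).
Hypotheses (hc1 : coefficients N k1 a1 p1) (hc2 : coefficients N k2 a2 p2).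
Hypotheses (sf1 : source f1) (sf2 : source f2).
Hypotheses (alpha0 : 0 < alpha) (beta0 : 0 < beta).

Let T1 := shoot N k1 a1 p1 f1 alpha.
Let T2 := shoot N k2 a2 p2 f2 beta.

(** * Upper bounds from the growth condition *)

Section Upper.
Variables (cbar : R) (h phi : R -> R).
Hypotheses (cbar0 : 0 < cbar) (ch : continuous_halfline h) (h0 : nonneg_halfline h).
Hypotheses (hnd : nondecreasing_halfline h).
Hypotheses (cphi : continuous_halfline phi) (phi0 : nonneg_halfline phi).
Let M := Mconst k2 f2 alpha beta.
Hypothesis hf : forall t w : R, 1 <= w -> M * kroot k2 (f2 alpha) <= t ->
  f1 (t * w) <= cbar * h t * phi w.

Let f2alpha : 0 < kroot k2 (f2 alpha).
Proof. by case: sf2 => _ _ _ f0; apply/kroot_gt0/f0. Qed.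

(** [M] is max(1, beta / f2(alpha)^(1/k2)), the least constant with this property and the next:
    [M_ge1] allows the factor [M] in front of [Q], and [betaM] absorbs the central value beta. *)
Let M_ge1 : 1 <= M.
Proof.
by rewrite /M /Mconst; case: ifPn => // /ltW H; rewrite ler_pdivlMr ?mul1r.
Qed.

Let betaM : beta <= M * kroot k2 (f2 alpha).
Proof.
rewrite /M /Mconst; case: ifPn => [H|]; first by rewrite divfK// gt_eqF.
by rewrite -leNgt mul1r.
Qed.

Let arg s := M * kroot k2 (f2 s).

Let le_arg s t : alpha <= s -> s <= t -> arg s <= arg t.
Proof.
move=> s0 st; case: sf2 => _ f0 fnd _; have s1 : 0 <= s by rewrite (le_trans _ s0)// ltW.
rewrite /arg ler_wpM2l ?(le_trans ler01)//; apply: le_kroot; first exact: f0.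
exact: fnd.
Qed.

Let arg_gt0 s : alpha <= s -> 0 < arg s.
Proof.
by move=> s0; apply: lt_le_trans (le_arg (lexx _) s0); apply: lt_le_trans betaM.
Qed.

(** If [h] vanished at [arg s], the growth condition with w = 1 would force f1(arg s) <= 0. *)
Let h_gt0 s : alpha <= s -> 0 < h (arg s).
Proof.
move=> s0; rewrite lt_neqAle h0 ?(ltW (arg_gt0 s0))// andbT eq_sym; apply/eqP => hs.
have := hf (lexx 1) (le_arg (lexx alpha) s0).
rewrite hs mulr0 mul0r mulr1 leNgt => /negP; apply.
by case: sf1 => _ _ _; apply; exact: arg_gt0.
Qed.

Let Phi t := phi (1 + Q N k2 a2 p2 t).

Let Phi_ge0 : nonneg_halfline Phi.
Proof. by move=> t _; apply: phi0; rewrite addr_ge0// Q_ge0. Qed.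

Let hPhi : loc_bounded_measurable Phi.
Proof. exact/loc_bounded_measurable_continuous/continuous_phiQ. Qed.

(* Freezing the integrand of [H] below [alpha] makes it continuous on the whole
   half-line, so that its primitive is also differentiable at [alpha]. *)
Let eta t := (kroot k1 (h (arg (Num.max t alpha))))^-1.

Let continuous_eta : continuous_halfline eta.
Proof.
have [/andP[k10 _] _ _ _ _] := hc1; have [/andP[k20 _] _ _ _ _] := hc2.
have [cf2 f20 _ _] := sf2.
have cmax : continuous_halfline (fun t => Num.max t alpha).
  apply: continuous_halflineW => x.
  by apply: continuous_max; [exact: cvg_id|exact: cvg_cst].
have max0 : nonneg_halfline (fun t => Num.max t alpha).
  by move=> t t0; rewrite le_max t0.
have carg : continuous_halfline (fun t => arg (Num.max t alpha)).
  apply: continuous_halflineM; first exact: continuous_halfline_cst.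
  apply: (@continuous_halfline_comp _ (kroot k2) (fun t => f2 (Num.max t alpha))).
  - exact: continuous_kroot.
  - exact: continuous_halfline_comp.
  - by move=> t t0; apply: f20; exact: max0.
have am t : alpha <= Num.max t alpha by rewrite le_max lexx orbT.
have ck : continuous_halfline (fun t => kroot k1 (h (arg (Num.max t alpha)))).
  apply: (@continuous_halfline_comp _ (kroot k1) (fun t => h (arg (Num.max t alpha)))).
  - exact: continuous_kroot.
  - apply: (@continuous_halfline_comp _ h (fun t => arg (Num.max t alpha))) => // t t0.
    by rewrite ltW// arg_gt0.
  - by move=> t t0; rewrite ltW// h_gt0.
apply/continuous_halflineP => x; apply: cvgV; last exact: cvg_halfline ck.
by rewrite gt_eqF// kroot_gt0// h_gt0.
Qed.

Let HE s : alpha <= s ->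
  H k1 h M k2 f2 alpha s = prim eta s - prim eta alpha.
Proof.
have heta := loc_bounded_measurable_continuous continuous_eta.
move=> s0; rewrite (prim_sub heta (ltW alpha0) s0).
apply: eq_Rintegral => t; rewrite inE/= in_itv/= => /andP[t0 _].
by rewrite /eta max_l.
Qed.

Lemma H_shoot_le v : increasing_above alpha v ->
  (forall r, 0 <= r -> v r <= T1 (T2 v) r) -> forall r, 0 <= r ->
  H k1 h M k2 f2 alpha (T1 (T2 v) r) <=
  kroot k1 cbar * P N k1 a1 p1 k2 a2 p2 phi r.
Proof.
move=> hv vT; have [/andP[k10 k1N] ca1 a10 cp1 p10] := hc1.
have [/andP[k20 k2N] ca2 a20 cp2 p20] := hc2.
have hT2 : increasing_above beta (T2 v) by exact: shoot_increasing_above hv.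
have hw : increasing_above alpha (T1 (T2 v)) by exact: shoot_increasing_above hT2.
have cw : continuous_halfline (T1 (T2 v)) by exact: continuous_shoot hT2.
set w := T1 (T2 v) in vT hw cw *.
have [f2v0 f2vnd] := source_comp sf2 alpha0 hv.
have [f1v0 f1vnd] := source_comp sf1 beta0 hT2.
(* For s <= t one has v s <= v t <= w t, so f2(w t) comes out of the source as a constant; this is
   where the subsolution property enters. *)
have T2w t : 0 <= t -> T2 v t <= arg (w t) * (1 + Q N k2 a2 p2 t).
  move=> t0; rewrite mulrDr mulr1 /T2 /shoot; apply: lerD.
    by apply: le_trans betaM _; exact: le_arg (lexx _) (hw.2 _ t0).
  rewrite Q_rise /arg; apply: (@le_trans _ _
    (kroot k2 (f2 (w t)) * rise N k2 a2 p2 (fun=> 1) t)).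
    apply: le_rise => //.
    - by case: sf2 => _ f0 _ _; apply: f0; rewrite (le_trans (ltW alpha0))// hw.2.
    - exact: loc_bounded_measurable_nondecreasing.
    - exact: loc_bounded_measurable_cst.
    - move=> s /andP[s0 st]; rewrite mulr1; case: sf2 => _ _ fnd _; apply: fnd.
        by rewrite (le_trans (ltW alpha0))// hv.2.
      by apply: le_trans (vT _ t0); exact: hv.1.
  by rewrite ler_wpM2r ?rise_ge0// ler_peMl// kroot_ge0.
(* Since [h], [arg] and [w] are monotone, the value of h(arg w) at the end point r bounds it on
   [0, r] and leaves the integral. *)
have slope_le r : 0 <= r -> slope N k1 a1 p1 (fun t => f1 (T2 v t)) r <=
    kroot k1 cbar * kroot k1 (h (arg (w r))) * slope N k1 a1 p1 Phi r.
  move=> r0; have hr : 0 <= h (arg (w r)) by rewrite ltW// h_gt0// hw.2.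
  rewrite -krootM ?(ltW cbar0)//; apply: le_slope => //.
  - by rewrite mulr_ge0// ltW.
  - exact: loc_bounded_measurable_nondecreasing.
  move=> t /andP[t0 tr].
  apply: (@le_trans _ _ (cbar * h (arg (w t)) * Phi t)).
    apply: (@le_trans _ _ (f1 (arg (w t) * (1 + Q N k2 a2 p2 t)))).
      case: sf1 => _ _ fnd _; apply: fnd; last exact: T2w.
      by rewrite (le_trans (ltW beta0))// hT2.2.
    by apply: hf; [rewrite lerDl Q_ge0|apply: le_arg => //; exact: hw.2].
  apply: ler_wpM2r; first exact: Phi_ge0.
  apply: ler_wpM2l; first exact: ltW.
  apply: hnd; first by apply: ltW; apply: arg_gt0; exact: hw.2.
  by apply: le_arg; [exact: hw.2|exact: hw.1].
(* Its derivative is nonnegative by [slope_le] divided by h(arg w)^(1/k1). As w 0 = alpha, comparing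
   [D r] with [D 0] is the claim. *)
pose D r := kroot k1 cbar * P N k1 a1 p1 k2 a2 p2 phi r - prim eta (w r).
have heta := loc_bounded_measurable_continuous continuous_eta.
have cD : continuous_halfline D.
  apply: continuous_halflineD.
    apply: continuous_halflineM; first exact: continuous_halfline_cst.
    exact: continuous_rise.
  apply: (@eq_continuous_halfline _ (fun r => -1 * prim eta (w r))).
    by move=> r _; rewrite mulN1r.
  apply: continuous_halflineM; first exact: continuous_halfline_cst.
  apply: (@continuous_halfline_comp _ (prim eta) w) => //; first exact: prim_continuous.
  by move=> r r0; rewrite (le_trans (ltW alpha0))// hw.2.
pose dD r := kroot k1 cbar * slope N k1 a1 p1 Phi r -
  eta (w r) * slope N k1 a1 p1 (fun t => f1 (T2 v t)) r.
have D_nd : nondecreasing_halfline D.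
  apply: (@nondecreasing_of_is_derive _ _ dD) => // r r0.
    have wr0 : 0 < w r by rewrite (lt_le_trans alpha0)// hw.2// ltW.
    have dw : is_derive r 1 w (slope N k1 a1 p1 (fun t => f1 (T2 v t)) r).
      have := is_deriveD (is_derive_cst alpha r 1)
        (is_derive_rise k10 k1N ca1 a10 cp1 p10 f1v0
          (loc_bounded_measurable_nondecreasing f1vnd) r0).
      by rewrite add0r.
    have dP : is_derive r 1 (P N k1 a1 p1 k2 a2 p2 phi) (slope N k1 a1 p1 Phi r).
      exact: is_derive_rise.
    have deta : is_derive (w r) 1 (prim eta) (eta (w r)).
      by apply: is_derive_prim => //; exact: continuous_halfline_at.
    have := is_deriveB (is_deriveZ (kroot k1 cbar) dP) (is_derive1_comp deta dw).
    exact.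
  have wr : alpha <= w r by rewrite hw.2// ltW.
  have hw0 : 0 < kroot k1 (h (arg (w r))) by apply: kroot_gt0; exact: h_gt0.
  have etaE : eta (w r) = (kroot k1 (h (arg (w r))))^-1 by rewrite /eta max_l.
  rewrite /dD subr_ge0 etaE mulrC (ler_pdivrMr _ _ hw0) mulrAC.
  exact: slope_le (ltW r0).
move=> r r0; rewrite HE ?hw.2//.
have w0 : w 0 = alpha by rewrite /w /T1 /shoot rise0 addr0.
have := D_nd _ _ (lexx 0) r0.
rewrite /D w0 (_ : P _ _ _ _ _ _ _ _ 0 = 0); last exact: prim0.
by rewrite mulr0 sub0r; lra.
Qed.

Hypothesis H_infty : lim_infinite (H k1 h M k2 f2 alpha).

Lemma H_coercive C : exists B, forall s, alpha <= s ->
  H k1 h M k2 f2 alpha s <= C -> s <= B.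
Proof.
have /cvgryPgt/(_ C) [B [_ hB]] := H_infty.
exists B => s _ HC; rewrite leNgt; apply/negP => /hB/=.
by rewrite ltNge HC.
Qed.

(** The right-hand side of [H_shoot_le] does not involve [v], so coercivity gives one bound for all
    subsolutions. *)
Lemma subsolution_bounded r : 0 <= r -> exists B, forall v, increasing_above alpha v ->
  (forall t, 0 <= t -> v t <= T1 (T2 v) t) -> v r <= B.
Proof.
move=> r0; have [B hB] := H_coercive (kroot k1 cbar * P N k1 a1 p1 k2 a2 p2 phi r).
exists B => v hv vT; apply: le_trans (vT _ r0) (hB _ _ _).
  by apply: le_trans (vT _ r0); exact: hv.2.
exact: H_shoot_le.
Qed.

(** A fixed point is a subsolution, and the nondecreasing [P] stays below its limit, so the bound is
    uniform in r. *)
Lemma lim_finite_fixpoint v : increasing_above alpha v -> v = T1 (T2 v) ->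
  lim_finite (P N k1 a1 p1 k2 a2 p2 phi) -> lim_finite v.
Proof.
move=> hv vT cP; have [/andP[k10 k1N] ca1 a10 cp1 p10] := hc1.
have P_nd : nondecreasing_halfline (P N k1 a1 p1 k2 a2 p2 phi).
  exact: rise_nondecreasing.
have [B hB] := H_coercive
  (kroot k1 cbar * lim (P N k1 a1 p1 k2 a2 p2 phi r @[r --> +oo])).
apply: (@lim_finite_bounded _ _ B) hv.1 _ => r r0; apply: hB; first exact: hv.2.
have vT' t : 0 <= t -> v t <= T1 (T2 v) t by rewrite -vT.
have := H_shoot_le hv vT' r0; rewrite -vT => /le_trans; apply.
by rewrite ler_wpM2l ?kroot_ge0//; exact: nondecreasing_le_lim.
Qed.

End Upper.

(** Since v >= alpha, T2 v is at least beta + f2(alpha)^(1/k2) Q; [mconst] is the minimum of the two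
    coefficients, so it factors out of this bound. *)
Lemma lim_infinite_fixpoint v c (phi : R -> R) : increasing_above alpha v ->
  v = T1 (T2 v) -> 0 < c -> continuous_halfline phi -> nonneg_halfline phi ->
  (forall w, 1 <= w -> c * phi w <= f1 (mconst k2 f2 alpha beta * w)) ->
  lim_infinite (P N k1 a1 p1 k2 a2 p2 phi) -> lim_infinite v.
Proof.
move=> hv vT c0 cphi phi0 hf; have [/andP[k10 k1N] ca1 a10 cp1 p10] := hc1.
have hT2 : increasing_above beta (T2 v) by exact: shoot_increasing_above hv.
have [f2v0 f2vnd] := source_comp sf2 alpha0 hv.
have [f1v0 f1vnd] := source_comp sf1 beta0 hT2.
have f2a0 : 0 < f2 alpha by case: sf2 => _ _ _; apply.
have m0 : 0 <= mconst k2 f2 alpha beta.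
  by rewrite /mconst le_min (ltW beta0) kroot_ge0.
apply: (@lim_infinite_ge _ _ _ (kroot k1 c) alpha); first exact: kroot_gt0.
move=> r r0; rewrite vT /T1 /shoot lerD2l; apply: ge_rise => //.
- by move=> t _; apply: phi0; rewrite addr_ge0// Q_ge0.
- exact: loc_bounded_measurable_nondecreasing.
- exact/loc_bounded_measurable_continuous/continuous_phiQ.
move=> t /andP[t0 tr]; have Q0 := @Q_ge0 _ N k2 a2 p2 t.
apply: (@le_trans _ _ (f1 (mconst k2 f2 alpha beta * (1 + Q N k2 a2 p2 t)))).
  by apply: hf; rewrite lerDl.
case: sf1 => _ _ fnd _; apply: fnd; first by rewrite mulr_ge0// addr_ge0.
rewrite mulrDr mulr1 /T2 /shoot; apply: lerD; first by rewrite /mconst ge_min lexx.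
apply: (@le_trans _ _ (kroot k2 (f2 alpha) * Q N k2 a2 p2 t)).
  by rewrite ler_wpM2r// /mconst ge_min lexx orbT.
rewrite Q_rise; apply: ge_rise => //.
- exact: loc_bounded_measurable_nondecreasing.
- exact: loc_bounded_measurable_cst.
move=> s /andP[s0 st]; rewrite mulr1; case: sf2 => _ _ f2nd _; apply: f2nd.
  exact: ltW.
exact: hv.2.
Qed.

(** * A fixed point as the supremum of the subsolutions *)

Section Existence.
Hypothesis bounded_subsolutions : forall r, 0 <= r -> exists B, forall v,
  increasing_above alpha v -> (forall t, 0 <= t -> v t <= T1 (T2 v) t) -> v r <= B.

Let T v := T1 (T2 v).

Let subsolution v := increasing_above alpha v /\ forall t, 0 <= t -> v t <= T v t.

Let T_increasing_above v : increasing_above alpha v -> increasing_above alpha (T v).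
Proof.
move=> hv; apply: (shoot_increasing_above _ hc1 sf1 beta0).
exact: (shoot_increasing_above _ hc2 sf2 alpha0).
Qed.

Let le_T v w r : increasing_above alpha v -> increasing_above alpha w ->
  (forall t, 0 <= t -> v t <= w t) -> T v r <= T w r.
Proof.
move=> hv hw vw; apply: (le_shoot _ hc1 sf1 beta0).
- exact: (shoot_increasing_above _ hc2 sf2 alpha0).
- exact: (shoot_increasing_above _ hc2 sf2 alpha0).
move=> t _; apply: (le_shoot _ hc2 sf2 alpha0) => // s /andP[s0 _].
exact: vw.
Qed.

Let values r := [set v r | v in [set v | subsolution v]].

Let has_sup_values r : 0 <= r -> has_sup (values r).
Proof.
move=> r0; split.
  (* The constant alpha is a subsolution because [T] takes values above alpha. *)
  exists alpha; exists (fun=> alpha) => //.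
  have hcst : increasing_above alpha (fun=> alpha) by split.
  by split => // t t0; exact: (T_increasing_above hcst).2.
have [B hB] := bounded_subsolutions r0.
by exists B => _ [v [hv vT] <-]; exact: hB.
Qed.

(** A subsolution v satisfies v <= T v <= T U, so U <= T U; then T U is itself a subsolution, whence
    T U <= U. *)
Lemma fixpoint_exists : exists2 v, increasing_above alpha v & v = T1 (T2 v).
Proof.
pose U r := sup (values r).
have U_ub v r : subsolution v -> 0 <= r -> v r <= U r.
  by move=> hv r0; apply: ub_le_sup; [exact: (has_sup_values r0).2|exists v].
have U_le r B : 0 <= r -> (forall v, subsolution v -> v r <= B) -> U r <= B.
  move=> r0 hB; apply: ge_sup; first exact: (has_sup_values r0).1.
  by move=> _ [v hv <-]; exact: hB.
have hU : increasing_above alpha U.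
  split.
    move=> r s r0 rs; apply: U_le => // v hv.
    apply: le_trans (hv.1.1 _ _ r0 rs) _; apply: U_ub => //.
    exact: le_trans rs.
  move=> r r0; have [_ [v hv _]] := (has_sup_values r0).1.
  by apply: le_trans (U_ub v r hv r0); exact: hv.1.2.
have UT r : 0 <= r -> U r <= T U r.
  move=> r0; apply: U_le => // v hv; apply: le_trans (hv.2 _ r0) _.
  by apply: le_T => //; [exact: hv.1|move=> t t0; exact: U_ub].
have TU r : 0 <= r -> T U r <= U r.
  move=> r0; apply: (U_ub (T U) r _ r0); split; first exact: T_increasing_above.
  by move=> t _; apply: (le_T t hU (T_increasing_above hU)) => s; exact: UT.
(* [U] is known to equal [T U] only on the half-line, whereas [T U] satisfies the equation on all of
   R by [eq_shoot]. *)
exists (T U); first exact: T_increasing_above.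
have TUE r : 0 <= r -> T U r = U r by move=> r0; apply/eqP; rewrite eq_le TU ?UT.
have T2E : T2 (T U) = T2 U by apply: eq_shoot; exact: TUE.
exact: (congr1 T1 (esym T2E)).
Qed.

End Existence.

End Bounds.

(** * From the integral equation to the differential equation *)

Section ShootSolution.
Context {R : realType}.
Variables (N k : nat) (c d : R) (a p f v u : R -> R).
Hypotheses (hc : coefficients N k a p) (sf : source f).
Hypothesis uE : u = shoot N k a p f c v.
Hypotheses (c0 : 0 < c) (d0 : 0 < d) (hv : increasing_above d v).
Hypothesis cv : continuous_halfline v.

Lemma continuous_shoot_solution : continuous_halfline u.
Proof. by rewrite uE; exact: continuous_shoot hv. Qed.

Lemma shoot_solution0 : u 0 = c.
Proof. by rewrite uE /shoot rise0 addr0. Qed.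

Lemma shoot_solution_gt0 : pos_halfline u.
Proof. by move=> r _; rewrite uE /shoot ltr_wpDr ?rise_ge0. Qed.

(** Continuity of [v] makes the source continuous and positive, which provides g and s up to the
    origin; the rank one formula then reduces the k-Hessian equation to [slope_ratio_equation]. *)
Lemma shoot_solution :
  [/\ C2_halfline u, C2_space (fun x : 'rV[R]_N => u (enorm x))
    & hessian_eq k a p f (fun x : 'rV[R]_N => u (enorm x))
        (fun x : 'rV[R]_N => v (enorm x))].
Proof.
have [/andP[k0 kN] ca a0 cp p0] := hc; have [cf f0 fnd fpos] := sf.
pose F t := f (v t).
have v0 t : 0 <= t -> 0 < v t by move=> t0; apply: lt_le_trans d0 (hv.2 _ t0).
have cF : continuous_halfline F.
  by apply: continuous_halfline_comp => // t /v0/ltW.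
have F_gt0 : pos_halfline F by move=> t /v0/fpos.
have F_ge0 : nonneg_halfline F by move=> t /F_gt0/ltW.
have hF := loc_bounded_measurable_continuous cF.
have cu := continuous_shoot_solution.
pose g := slope_ratio N k a p F; pose s := slope_ratio_rate N k a p F.
have cg : continuous_halfline g by exact: continuous_slope_ratio.
have cs : continuous_halfline s by exact: continuous_slope_ratio_rate.
have s0 : s 0 = 0 by exact: slope_ratio_rate0.
have du (r : R) : 0 < r -> is_derive r 1 u (r * g r).
  move=> r0; rewrite -slope_quot_ext ?(ltW r0)//.
  have := is_deriveD (is_derive_cst c r 1) (is_derive_rise k0 kN ca a0 cp p0 F_ge0 hF r0).
  by rewrite add0r uE.
have dg (r : R) : 0 < r -> is_derive r 1 g (s r / r) by exact: is_derive_slope_ratio.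
split; first exact: C2_halfline_radial dg.
  exact: C2_space_radial dg.
move=> x; have x0 := enorm_ge0 x.
have g0 : 0 < g (enorm x) by apply: kroot_gt0; exact: quot_ext_gt0.
rewrite (hessian_radial cu cg cs s0 du dg) (enorm_grad_radial cu cg du) ?(ltW g0)//.
rewrite Sk_scalar_add_rank1 ?gt_eqF// -enorm_sqr.
(* At the origin the left side is 0 by the convention x / 0 = 0, in agreement with s(0) = 0. *)
have -> : s (enorm x) / enorm x ^+ 2 * enorm x ^+ 2 = s (enorm x).
  have [e0|e0] := eqVneq (enorm x) 0; last by rewrite divfK// expf_neq0.
  by rewrite e0 s0 !mul0r.
exact: slope_ratio_equation.
Qed.

End ShootSolution.

Theorem theorem1 (R : realType) (N k1 k2 : nat) (a b : R)
    (a1 a2 p1 p2 f1 f2 : R -> R)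
    (cbar1 cbar2 : R) (h1 h2 phibar1 phibar2 : R -> R) :
  (3 <= N)%N -> (1 <= k1 <= N)%N -> (1 <= k2 <= N)%N ->
  0 < a -> 0 < b ->
  continuous_halfline a1 -> nonneg_halfline a1 ->
  continuous_halfline a2 -> nonneg_halfline a2 ->
  continuous_halfline p1 -> pos_halfline p1 ->
  continuous_halfline p2 -> pos_halfline p2 ->
  continuous_halfline f1 -> nonneg_halfline f1 ->
  nondecreasing_halfline f1 -> (forall s, 0 < s -> 0 < f1 s) ->
  continuous_halfline f2 -> nonneg_halfline f2 ->
  nondecreasing_halfline f2 -> (forall s, 0 < s -> 0 < f2 s) ->
  0 < cbar1 -> 0 < cbar2 ->
  continuous_halfline h1 -> nonneg_halfline h1 -> nondecreasing_halfline h1 ->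
  continuous_halfline h2 -> nonneg_halfline h2 -> nondecreasing_halfline h2 ->
  continuous_halfline phibar1 -> nonneg_halfline phibar1 ->
  continuous_halfline phibar2 -> nonneg_halfline phibar2 ->
  let M1 := Mconst k2 f2 a b in
  let M2 := Mconst k1 f1 b a in
  let m1 := mconst k2 f2 a b in
  let m2 := mconst k1 f1 b a in
  let P12 := P N k1 a1 p1 k2 a2 p2 in
  let P21 := P N k2 a2 p2 k1 a1 p1 in
  let H12 := H k1 h1 M1 k2 f2 a in
  let H21 := H k2 h2 M2 k1 f1 b in
  (forall t w, 1 <= w -> M1 * kroot k2 (f2 a) <= t ->
     f1 (t * w) <= cbar1 * h1 t * phibar1 w) ->
  (forall t w, 1 <= w -> M2 * kroot k1 (f1 b) <= t ->
     f2 (t * w) <= cbar2 * h2 t * phibar2 w) ->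
  lim_infinite H12 -> lim_infinite H21 ->
  let lower1 (c : R) (phi : R -> R) :=
    [/\ 0 < c, continuous_halfline phi, nonneg_halfline phi
      & forall w, 1 <= w -> c * phi w <= f1 (m1 * w)] in
  let lower2 (c : R) (phi : R -> R) :=
    [/\ 0 < c, continuous_halfline phi, nonneg_halfline phi
      & forall w, 1 <= w -> c * phi w <= f2 (m2 * w)] in
  exists u1 u2 : R -> R,
    let U1 (x : 'rV[R]_N) := u1 (enorm x) in
    let U2 (x : 'rV[R]_N) := u2 (enorm x) in
    [/\ [/\ C2_halfline u1, C2_halfline u2, pos_halfline u1 & pos_halfline u2],
        u1 0 = a /\ u2 0 = b,
        C2_space U1 /\ C2_space U2,
        hessian_eq k1 a1 p1 f1 U1 U2 /\ hessian_eq k2 a2 p2 f2 U2 U1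
      & [/\ lim_finite (P12 phibar1) -> lim_finite (P21 phibar2) ->
              lim_finite u1 /\ lim_finite u2,
            forall (c1 c2 : R) (phi1 phi2 : R -> R),
              lower1 c1 phi1 -> lower2 c2 phi2 ->
              lim_infinite (P12 phi1) -> lim_infinite (P21 phi2) ->
              lim_infinite u1 /\ lim_infinite u2,
            forall (c2 : R) (phi2 : R -> R),
              lower2 c2 phi2 ->
              lim_finite (P12 phibar1) -> lim_infinite (P21 phi2) ->
              lim_finite u1 /\ lim_infinite u2
          & forall (c1 : R) (phi1 : R -> R),
              lower1 c1 phi1 ->
              lim_infinite (P12 phi1) -> lim_finite (P21 phibar2) ->
              lim_infinite u1 /\ lim_finite u2]].

Proof.
move=> _ k1N k2N a0 b0 ca1 a10 ca2 a20 cp1 p10 cp2 p20 cf1 f10 f1nd f1pos.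
move=> cf2 f20 f2nd f2pos cbar10 cbar20 ch1 h10 h1nd ch2 h20 h2nd.
move=> cphi1 phi10 cphi2 phi20 M1 M2 m1 m2 P12 P21 H12 H21 hf1 hf2 H12y H21y.
move=> lower1 lower2.
have hc1 : coefficients N k1 a1 p1 by [].
have hc2 : coefficients N k2 a2 p2 by [].
have sf1 : source f1 by [].
have sf2 : source f2 by [].
have [u1 hu1 u1E] := fixpoint_exists hc1 hc2 sf1 sf2 a0 b0
  (subsolution_bounded hc1 hc2 sf1 sf2 a0 b0 cbar10 ch1 h10 h1nd cphi1 phi10 hf1 H12y).
pose u2 := shoot N k2 a2 p2 f2 b u1.
have hu2 : increasing_above b u2 by exact: shoot_increasing_above hu1.
(* [u2] is a fixed point of the composition in the other order, so the growth lemmas apply to it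
   with the two equations exchanged. *)
have u2E : u2 = shoot N k2 a2 p2 f2 b (shoot N k1 a1 p1 f1 a u2).
  exact (congr1 (shoot N k2 a2 p2 f2 b) u1E).
(* Monotone sources already give continuous components; each continuity then feeds the C^2
   regularity of the other component. *)
have cu1 := continuous_shoot_solution hc1 sf1 u1E b0 hu2.
have cu2 := continuous_shoot_solution hc2 sf2 (erefl u2) a0 hu1.
have fin1 : lim_finite (P12 phibar1) -> lim_finite u1.
  exact: (lim_finite_fixpoint hc1 hc2 sf1 sf2 a0 b0 cbar10 ch1 h10 h1nd
    cphi1 phi10 hf1 H12y hu1 u1E).
have fin2 : lim_finite (P21 phibar2) -> lim_finite u2.
  exact: (lim_finite_fixpoint hc2 hc1 sf2 sf1 b0 a0 cbar20 ch2 h20 h2nd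
    cphi2 phi20 hf2 H21y hu2 u2E).
have inf1 c phi : lower1 c phi -> lim_infinite (P12 phi) -> lim_infinite u1.
  move=> [c0 cphi phi0 hphi].
  exact: (lim_infinite_fixpoint hc1 hc2 sf1 sf2 a0 b0 hu1 u1E c0 cphi phi0 hphi).
have inf2 c phi : lower2 c phi -> lim_infinite (P21 phi) -> lim_infinite u2.
  move=> [c0 cphi phi0 hphi].
  exact: (lim_infinite_fixpoint hc2 hc1 sf2 sf1 b0 a0 hu2 u2E c0 cphi phi0 hphi).
have [C2u1 C2U1 eq1] := shoot_solution hc1 sf1 u1E b0 hu2 cu2.
have [C2u2 C2U2 eq2] := shoot_solution hc2 sf2 (erefl u2) a0 hu1 cu1.
have u1_gt0 := shoot_solution_gt0 u1E a0.
have u2_gt0 := shoot_solution_gt0 (erefl u2) b0.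
exists u1, u2; split.
- by split.
- by split; [exact: shoot_solution0 u1E|exact: shoot_solution0 (erefl u2)].
- by split.
- by split.
- split.
  + by move=> P1 P2; exact (conj (fin1 P1) (fin2 P2)).
  + by move=> c1 c2 phi1 phi2 l1 l2 P1 P2; exact (conj (inf1 _ _ l1 P1) (inf2 _ _ l2 P2)).
  + by move=> c2 phi2 l2 P1 P2; exact (conj (fin1 P1) (inf2 _ _ l2 P2)).
  + by move=> c1 phi1 l1 P1 P2; exact (conj (inf1 _ _ l1 P1) (fin2 P2)).
Qed.
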